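(* Let $F:\mathcal{H}\to\mathbb{C}[D]$ be smooth and $\Phi_{L,v}^{F,H}(\tau,\zeta):=\downarrow_{H}\big(\Theta_{L}(\tau,\zeta;v)\otimes F(\tau)\big)$. Let $\Lambda$ be an even lattice with $L\subseteq\Lambda\subseteq L^*$ such that $I_L:=\Lambda/L\subseteq H_L$, and let $I\subseteq H_D$ be the image of $I_L$ under the isomorphism $H_L\cong H\cong H_D$. Assume that every scalar component $\Phi_\beta$ ($\beta\in\Delta_H$) of $\Phi_{L,v}^{F,H}$ satisfies $\Phi_\beta(\tau,\zeta+\tau\sigma_{v_+}+\overline\tau\sigma_{v_-}+\nu)=\mathbf{e}\big(-\tau\frac{\sigma_{v_+}^2}{2}-\overline\tau\frac{\sigma_{v_-}^2}{2}-(\sigma,\zeta)\big)\Phi_\beta(\tau,\zeta)$ for all $\sigma,\nu\in\Lambda$. Then there is a unique function $G:\mathcal{H}\to\mathbb{C}[\overline{D}]$, where $\overline D=I^{\perp}/I$ with $I^\perp\subseteq D$, such that $F=\uparrow_{I}G$, and $\Phi_{L,v}^{F,H}=\mathcal{P}\,\Phi_{\Lambda,v}^{G,\overline{H}}$ with $\overline{H}=(H\cap I^{\perp})/I_{H}$ and $\Phi_{\Lambda,v}^{G,\overline{H}}(\tau,\zeta):=\downarrow_{\overline H}\big(\Theta_\Lambda(\tau,\zeta;v)\otimes G(\tau)\big)$.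
   Context: Discriminant forms: finite abelian groups with a $\mathbb{Q}/\mathbb{Z}$-valued quadratic form with non-degenerate bilinear form $(\cdot,\cdot)$; $Y^\perp$ orthogonal subgroup; isotropic = quadratic form vanishes. For isotropic $Y$ in a discriminant form $E$: $\uparrow_Y:\mathbb{C}[Y^\perp/Y]\to\mathbb{C}[E]$, $\uparrow_Y\mathfrak{e}_\gamma=\sum_{\delta\in Y^\perp,\delta+Y=\gamma}\mathfrak{e}_\delta$; $\downarrow_Y:\mathbb{C}[E]\to\mathbb{C}[Y^\perp/Y]$, $\downarrow_Y\mathfrak{e}_\delta=\mathfrak{e}_{\delta+Y}$ if $\delta\in Y^\perp$, else $0$. Let $L$ be an even lattice over $\mathbb{Z}$ of signature $(b_+,b_-)$, bilinear form $(\cdot,\cdot)$, $\lambda^2=(\lambda,\lambda)$, dual $L^*$, $D_L=L^*/L$; fix $v$: $L_\mathbb{R}=v_+\oplus v_-$ orthogonal with $v_+$ positive and $v_-$ negative definite; $x_{v_\pm}$ $\mathbb{C}$-linear projections. For an even lattice $N$ with $N_\mathbb{R}=L_\mathbb{R}$, $\Theta_N(\tau,\zeta;v)=\sum_{\gamma\in D_N}\big[\sum_{\lambda\in N+\gamma}\mathbf{e}(\tau\frac{\lambda_{v_+}^2}{2}+\overline\tau\frac{\lambda_{v_-}^2}{2}+(\lambda,\zeta))\big]\mathfrak{e}_\gamma$, $\zeta\in L_\mathbb{C}$, $\mathbf{e}(z)=e^{2\pi iz}$. $D$ is a discriminant form, $H\subseteq D_L\oplus D$ an isotropic horizontal subgroup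 ($H\cap D_L=H\cap D=0$), elements written $\gamma=(\gamma_L,\gamma_D)$, $H_L,H_D$ the (isomorphic) projections of $H$, $\Delta_H=H^\perp/H$, $\mathbb{C}[D_L]\otimes\mathbb{C}[D]=\mathbb{C}[D_L\oplus D]$. With $I\subseteq H_D$ as in the claim: $I_H:=\{\gamma\in H:\gamma_D\in I\}$ (whose projection to $D_L$ is $I_L$), $H\cap I^\perp:=\{\gamma\in H:\gamma_D\in I^\perp\}$, $D_\Lambda=\Lambda^*/\Lambda$ identified with $I_L^\perp/I_L$. The map $\gamma\mapsto(\gamma_L+I_L,\gamma_D+I)$ (one has $\gamma_L\in I_L^\perp$) identifies $\overline H=(H\cap I^\perp)/I_H$ with a horizontal isotropic subgroup of $D_\Lambda\oplus\overline D$; $\overline\Delta_{\overline H}:=\overline H^\perp/\overline H$. For $\beta\in\Delta_H$ having a representative $x\in H^\perp$ with $x_D\in I^\perp$ (then $x_L\in I_L^\perp$), $p(\beta):=(x_L+I_L,x_D+I)+\overline H\in\overline\Delta_{\overline H}$ is well defined, and $\mathcal{P}:\mathbb{C}[\overline\Delta_{\overline H}]\to\mathbb{C}[\Delta_H]$ is $\mathcal{P}\mathfrak{e}_\alpha=\sum_{\beta:\,p(\beta)=\alpha}\mathfrak{e}_\beta$ (the composition $\downarrow_{H/(H\cap I^\perp)}\circ\uparrow_{\overline I}$ of the paper). *)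

(* Defs.v *)
From HB Require Import structures.
From mathcomp Require Import all_boot all_order all_algebra.
From mathcomp Require Import ring_quotient complex ring.
From mathcomp Require Import all_classical all_reals all_analysis.

Set Implicit Arguments.
Unset Strict Implicit.
Unset Printing Implicit Defensive.

Import Order.TTheory GRing.Theory Num.Theory.
Import numFieldNormedType.Exports.

Local Open Scope classical_set_scope.
Local Open Scope ring_scope.
Local Open Scope quotient_scope.

Definition intQ : {pred rat} := fun x => x \is a Num.int.

Lemma intQ_zmod_closed : zmod_closed intQ.
Proof.
by split=> [|x y]; rewrite !unfold_in /intQ ?rpred0 //; exact: rpredB.
Qed.

HB.instance Definition _ := GRing.isZmodClosed.Build rat intQ intQ_zmod_closed.

Notation QmodZ := (Quotient.quot intQ).

Definition toQmodZ (r : rat) : QmodZ := \pi_QmodZ r.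

Definition polar (A : zmodType) (q : A -> QmodZ) (x y : A) : QmodZ :=
  q (x + y) - q x - q y.

(* The carrier may be infinite and the form degenerate: the rational span of a
   lattice, with x^2/2 mod Z, is also an instance (see [ratquad]). *)
Record quadMod := QuadMod {
  qm_sort :> zmodType;
  qform : qm_sort -> QmodZ;
  qform_scale : forall (n : int) (x : qm_sort),
    qform (x *~ n) = qform x *~ (n ^+ 2);
  polar_addl : forall x y z : qm_sort,
    polar qform (x + y) z = polar qform x z + polar qform y z
}.

Section QuadMod.
Variable E : quadMod.
Implicit Types (x y : E).

Definition bform x y : QmodZ := polar (@qform E) x y.

Definition discriminant_form : Prop :=
  finite_set [set: E] /\
  (forall x : E, (forall y : E, bform x y = 0) -> x = 0).

Lemma bformC x y : bform x y = bform y x.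
Proof. by rewrite /bform /polar [x + y]addrC addrAC. Qed.

Lemma bformDl x y z : bform (x + y) z = bform x z + bform y z.
Proof. exact: polar_addl. Qed.

Lemma bform0l y : bform 0 y = 0.
Proof. by apply: (addrI (bform 0 y)); rewrite -bformDl !addr0. Qed.

Lemma bformBl x y z : bform (x - y) z = bform x z - bform y z.
Proof.
by apply: (addIr (bform y z)); rewrite -bformDl !subrK.
Qed.

Lemma qformD x y : qform (x + y) = qform x + qform y + bform x y.
Proof.
by rewrite /bform /polar -[_ - _ - _]addrA -opprD [RHS]addrC subrK.
Qed.

Definition perp (Y : {pred E}) : {pred E} :=
  fun x => `[< forall y, y \in Y -> bform x y = 0 >].

Lemma perpP (Y : {pred E}) x :
  reflect (forall y, y \in Y -> bform x y = 0) (x \in perp Y).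
Proof. exact: asboolP. Qed.

Lemma perp_zmod_closed Y : zmod_closed (perp Y).
Proof.
split=> [|x y /perpP xY /perpP yY]; apply/perpP => z zY.
  by rewrite bform0l.
by rewrite bformBl xY // yY // subrr.
Qed.

HB.instance Definition _ Y :=
  GRing.isZmodClosed.Build E (perp Y) (perp_zmod_closed Y).

Definition perp_sub (Y : {pred E}) := {x : E | x \in perp Y}.
HB.instance Definition _ Y := SubChoice.on (perp_sub Y).
HB.instance Definition _ Y :=
  [SubChoice_isSubZmodule of perp_sub Y by <:].

Definition in_perp_sub (Y : {pred E}) : {pred perp_sub Y} :=
  fun u => val u \in Y.
Arguments in_perp_sub Y : clear implicits.

Lemma in_perp_sub_zmod_closed (Y : zmodClosed E) : zmod_closed (in_perp_sub Y).
Proof.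
split=> [|x y xY yY]; first exact: (rpred0 Y).
exact: (@rpredB _ Y).
Qed.

HB.instance Definition _ (Y : zmodClosed E) :=
  GRing.isZmodClosed.Build (perp_sub Y) (in_perp_sub Y)
    (in_perp_sub_zmod_closed Y).

Record isotropic := Isotropic {
  iso_sub :> zmodClosed E;
  iso_qform0 : forall x, x \in iso_sub -> qform x = 0
}.

End QuadMod.

Arguments in_perp_sub {E} Y.

Section PerpQuotient.
Variables (E : quadMod) (Y : isotropic E).

Definition perp_quot_zmod : zmodType := Quotient.quot (in_perp_sub Y).

Definition perp_quot_q (c : perp_quot_zmod) : QmodZ :=
  qform (val (repr c : perp_sub Y)).

Lemma perp_quot_qE (u : perp_sub Y) :
  perp_quot_q (\pi_(Quotient.quot (in_perp_sub Y)) u) = qform (val u).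
Proof.
rewrite /perp_quot_q.
set w := repr _.
have : w - u \in in_perp_sub Y by rewrite Quotient.idealrBE reprK.
rewrite unfold_in /in_perp_sub raddfB /= => dY.
have -> : val w = val u + (val w - val u) by rewrite addrC subrK.
rewrite qformD (iso_qform0 dY) addr0.
by have /perpP -> // := valP u; rewrite addr0.
Qed.

Lemma perp_quot_scale (n : int) c :
  perp_quot_q (c *~ n) = perp_quot_q c *~ (n ^+ 2).
Proof.
rewrite -[c]reprK -raddfMz !perp_quot_qE raddfMz; exact: qform_scale.
Qed.

Lemma perp_quot_polar (c d e : perp_quot_zmod) :
  polar perp_quot_q (c + d) e = polar perp_quot_q c e + polar perp_quot_q d e.
Proof.
rewrite -[c]reprK -[d]reprK -[e]reprK /polar -!raddfD !perp_quot_qE !raddfD.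
exact: polar_addl.
Qed.

Definition perp_quot : quadMod :=
  @QuadMod perp_quot_zmod perp_quot_q perp_quot_scale perp_quot_polar.

(* Only meaningful for x in the orthogonal subgroup of Y; elsewhere it is 0. *)
Definition coset_perp (x : E) : perp_quot :=
  \pi_(Quotient.quot (in_perp_sub Y)) (insubd (0 : perp_sub Y) x).

End PerpQuotient.

Section CosetTheory.
Variables (E : quadMod) (Y : isotropic E).
Implicit Types x y : E.

Lemma coset_perp_qE x : x \in perp Y -> qform (coset_perp Y x) = qform x.
Proof.
by move=> xY; rewrite /coset_perp /= perp_quot_qE val_insubd xY.
Qed.

Lemma coset_perpB x y : x \in perp Y -> y \in perp Y ->
  coset_perp Y (x - y) = coset_perp Y x - coset_perp Y y.
Proof.
move=> xY yY; rewrite /coset_perp -raddfB; congr (\pi_ _ _).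
by apply: val_inj; rewrite raddfB /= !val_insubd xY yY rpredB.
Qed.

Lemma coset_perp0 : coset_perp Y 0 = 0.
Proof. by rewrite -(subrr (0 : E)) coset_perpB ?rpred0 // subrr. Qed.

Lemma coset_perp_eq x y : x \in perp Y -> y \in perp Y ->
  (coset_perp Y x = coset_perp Y y) <-> (x - y \in iso_sub Y).
Proof.
move=> xY yY.
have <- : val (insubd (0 : perp_sub Y) x - insubd (0 : perp_sub Y) y) = x - y.
  by rewrite raddfB /= !val_insubd xY yY.
rewrite -[_ \in iso_sub Y]/(_ \in in_perp_sub Y) Quotient.idealrBE.
by split => [/eqP|/eqP].
Qed.

End CosetTheory.

Section DirectSum.
Variables A B : quadMod.

Let qsum (x : (A * B)%type) : QmodZ := qform x.1 + qform x.2.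

Lemma qsum_scale (n : int) x : qsum (x *~ n) = qsum x *~ (n ^+ 2).
Proof.
by rewrite /qsum !raddfMz /= !qform_scale mulrzDl.
Qed.

Lemma qsum_polarE x y :
  polar qsum x y = polar (@qform A) x.1 y.1 + polar (@qform B) x.2 y.2.
Proof. by rewrite /polar /qsum /= !opprD (addrACA (qform _)) (addrACA (_ - _)). Qed.

Lemma qsum_polar x y z : polar qsum (x + y) z = polar qsum x z + polar qsum y z.
Proof. by rewrite !qsum_polarE /= !polar_addl addrACA. Qed.

Definition dsum : quadMod := @QuadMod (A * B)%type qsum qsum_scale qsum_polar.

Lemma dsum_qformE (x : dsum) : qform x = qform x.1 + qform x.2.
Proof. by []. Qed.
End DirectSum.

Definition bil (K : comNzRingType) (n : nat) (S : 'M[K]_n) (x y : 'rV[K]_n) : K :=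
  (x *m S *m y^T) 0 0.

Section Bil.
Variables (K : comNzRingType) (n : nat) (S : 'M[K]_n).
Implicit Types x y z : 'rV[K]_n.

Lemma bilDl x y z : bil S (x + y) z = bil S x z + bil S y z.
Proof. by rewrite /bil !mulmxDl mxE. Qed.

Lemma bilDr x y z : bil S z (x + y) = bil S z x + bil S z y.
Proof. by rewrite /bil linearD mulmxDr mxE. Qed.

Lemma bilC x y : S^T = S -> bil S x y = bil S y x.
Proof.
move=> SS; rewrite /bil -[in LHS](trmxK (x *m S)) -trmx_mul mxE.
by rewrite trmx_mul SS mulmxA.
Qed.

Lemma bilMzl (m : int) x y : bil S (x *~ m) y = bil S x y *~ m.
Proof.
by rewrite -scaler_int /bil -!scalemxAl mxE mulrzl.
Qed.

Lemma bilMzr (m : int) x y : bil S x (y *~ m) = bil S x y *~ m.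
Proof.
by rewrite -scaler_int /bil linearZ -scalemxAr mxE mulrzl.
Qed.
End Bil.

Record quadSpace (n : nat) := QuadSpace {
  gram :> 'M[rat]_n;
  gram_sym : gram^T = gram;
  gram_nondeg : gram \in unitmx
}.

Section RatQuad.
Variables (n : nat) (S : quadSpace n).

Let q (x : 'rV[rat]_n) : QmodZ := toQmodZ (bil S x x / 2).

Lemma ratquad_scale (m : int) x : q (x *~ m) = q x *~ (m ^+ 2).
Proof.
by rewrite /q bilMzl bilMzr -mulrzA mulrzAl /toQmodZ raddfMz.
Qed.

Lemma ratquad_polarE x y : polar q x y = toQmodZ (bil S x y).
Proof.
rewrite /polar /q /toQmodZ -!raddfB; congr (\pi_ _ _).
rewrite !bilDl !bilDr (bilC y x (gram_sym S)).
by field.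
Qed.

Lemma ratquad_polar x y z : polar q (x + y) z = polar q x z + polar q y z.
Proof. by rewrite !ratquad_polarE bilDl /toQmodZ raddfD. Qed.

Definition ratquad : quadMod :=
  @QuadMod 'rV[rat]_n q ratquad_scale ratquad_polar.
End RatQuad.

(* The ambient space is L_Q = Q^n in coordinates, with Gram matrix S; a lattice
   is the Z-span of some basis of it. *)
Record evenLattice (n : nat) (S : quadSpace n) := EvenLattice {
  lat :> zmodClosed 'rV[rat]_n;
  lat_basis : exists2 B : 'M[rat]_n, B \in unitmx &
    forall x, x \in lat <-> exists z : 'rV[int]_n, x = map_mx intr z *m B;
  lat_even : forall x, x \in lat -> exists k : int, bil S x x = (2 * k)%:~R
}.

Section Lattice.
Variables (n : nat) (S : quadSpace n).
Implicit Types N : evenLattice S.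

Lemma toQmodZ_eq0 (r : rat) : (toQmodZ r = 0) <-> (r \is a Num.int).
Proof.
have -> : (r \is a Num.int) = (r - 0 \in intQ) by rewrite subr0.
by rewrite Quotient.idealrBE -[0 in X in X <-> _](raddf0 \pi_QmodZ); split => /eqP.
Qed.

Lemma lat_qform0 N (x : ratquad S) : x \in lat N -> qform x = 0.
Proof.
case/lat_even => k Ek; apply/toQmodZ_eq0.
by rewrite Ek mulrC intrM mulrA mulVf // mul1r intr_int.
Qed.

Definition lat_iso N : isotropic (ratquad S) :=
  @Isotropic (ratquad S) (lat N) (@lat_qform0 N).

(* The polar form of [ratquad S] is [bil S] mod Z, so that orthogonality to N is
   integrality against N; hence also D_N = N^*/N is an instance of Y^perp/Y. *)
Definition dual_lattice N : {pred 'rV[rat]_n} := perp (lat_iso N).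

HB.instance Definition _ N :=
  GRing.isZmodClosed.Build 'rV[rat]_n (dual_lattice N)
    (@perp_zmod_closed (ratquad S) (lat_iso N)).

Lemma dual_latticeP N x :
  x \in dual_lattice N <-> (forall y, y \in N -> bil S x y \is a Num.int).
Proof.
split=> [/perpP xN y yN | xN].
  by apply/toQmodZ_eq0; rewrite -ratquad_polarE; exact: xN.
apply/perpP => y yN; rewrite /bform [LHS]ratquad_polarE.
by apply/toQmodZ_eq0; exact: xN.
Qed.

Definition disc N : quadMod := perp_quot (lat_iso N).

Definition disc_coset N (x : 'rV[rat]_n) : disc N := coset_perp (lat_iso N) x.

End Lattice.

Section DiscFinite.
Variables (n : nat) (S : quadSpace n) (N : evenLattice S).

Lemma disc_coset_surj (c : disc N) :
  exists2 x : 'rV[rat]_n, x \in dual_lattice N & disc_coset N x = c.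
Proof.
exists (val (repr c : perp_sub (lat_iso N))); first exact: valP.
by rewrite /disc_coset /coset_perp valKd reprK.
Qed.

Lemma lat_sub_dual x : x \in lat N -> x \in dual_lattice N.
Proof.
move=> xN; apply/perpP => y yN; rewrite /bform /polar.
by rewrite !(@lat_qform0 _ _ N) ?subrr // (@rpredD _ (lat N)).
Qed.

Lemma int_mx (m : nat) (A : 'M[rat]_(m, n)) :
  (forall i j, A i j \is a Num.int) -> exists Z : 'M[int]_(m, n), A = map_mx intr Z.
Proof.
move=> AZ; exists (\matrix_(i, j) Num.floor (A i j)).
by apply/matrixP => i j; rewrite !mxE floorK.
Qed.

Lemma dual_lattice_coord (B : 'M[rat]_n) :
  (forall x, x \in lat N <-> exists z : 'rV[int]_n, x = map_mx intr z *m B) ->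
  forall x, x \in dual_lattice N <->
    exists z : 'rV[int]_n, x *m (S *m B^T) = map_mx intr z.
Proof.
move=> NB x; split=> [/dual_latticeP xN | [z Ez]].
  apply: int_mx => i j; rewrite ord1.
  have /xN : row j B \in lat N.
    apply/NB; exists (delta_mx 0 j); rewrite rowE; congr (_ *m _).
    by apply/matrixP => k l; rewrite !mxE; case: (_ && _).
  suff -> : bil S x (row j B) = (x *m (S *m B^T)) 0 j by [].
  by rewrite mulmxA /bil mxE [RHS]mxE; apply: eq_bigr => k _; rewrite !mxE.
apply/dual_latticeP => y /NB[w ->].
rewrite /bil trmx_mul [_ *m (_ *m _)]mulmxA -(mulmxA x) Ez map_trmx -map_mxM mxE.
exact: intr_int.
Qed.

Lemma disc_discriminant_form : discriminant_form (disc N).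
Proof.
have [B Bu NB] := lat_basis N.
have dualE := dual_lattice_coord NB.
set T := S *m B^T in dualE.
have Tu : T \in unitmx by rewrite unitmx_mul gram_nondeg unitmx_tr.
split; last first.
  move=> c c0; have [x xd Ex] := disc_coset_surj c.
  rewrite -Ex -(coset_perp0 (lat_iso N)); apply/coset_perp_eq => //.
    exact: rpred0.
  rewrite subr0; apply/NB.
  have xZ y : y \in dual_lattice N -> bil S x y \is a Num.int.
    move=> yd; apply/toQmodZ_eq0; rewrite -ratquad_polarE.
    have := c0 (disc_coset N y); rewrite -Ex /bform /polar /disc_coset => <-.
    have -> : coset_perp (lat_iso N) x + coset_perp (lat_iso N) y =
              coset_perp (lat_iso N) (x + y).
      rewrite -[y in RHS]opprK coset_perpB ?rpredN // -[- y]sub0r.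
      by rewrite coset_perpB ?rpred0 // coset_perp0 sub0r opprK.
    by rewrite !coset_perp_qE // rpredD.
  have [z Ez] : exists z : 'rV[int]_n, x *m invmx B = map_mx intr z.
    apply: int_mx => i j; rewrite ord1.
    have : row j (invmx T) \in dual_lattice N.
      apply/dualE; apply: int_mx => k l; rewrite -row_mul mulVmx // !mxE.
      by case: (_ == _).
    move/xZ; suff -> : bil S x (row j (invmx T)) = (x *m invmx B) 0 j by [].
    have -> : invmx B = S *m (invmx T)^T.
      apply: (can_inj (mulKmx Bu)); rewrite mulmxV // mulmxA.
      have -> : B *m S = T^T by rewrite trmx_mul trmxK gram_sym.
      by rewrite -trmx_mul mulVmx // trmx1.
    by rewrite mulmxA /bil mxE [RHS]mxE; apply: eq_bigr => k _; rewrite !mxE.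
  by exists z; rewrite -Ez mulmxKV.
have [M EM] : exists M : 'M[int]_n, B *m T = map_mx intr M.
  apply: int_mx => i j.
  have : row i B \in dual_lattice N.
    apply/lat_sub_dual/NB; exists (delta_mx 0 i); rewrite rowE; congr (_ *m _).
    by apply/matrixP => k l; rewrite !mxE; case: (_ && _).
  move/dualE => [z]; rewrite -row_mul => /matrixP/(_ 0 j); rewrite !mxE => ->.
  exact: intr_int.
pose d := \det M.
have d0 : d != 0.
  have : B *m T \in unitmx by rewrite unitmx_mul Bu.
  by rewrite EM unitmxE det_map_mx unitfE intr_eq0.
have dq0 : d%:~R != 0 :> rat by rewrite intr_eq0.
pose f (w : 'rV['I_`|d|%N]_n) : disc N :=
  disc_coset N ((d%:~R)^-1 *: (map_mx (fun k : 'I_`|d|%N => (k : nat)%:R) w *m B)).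
apply: (@sub_finite_set _ _ (f @` setT)); last exact: finite_image.
move=> c _; have [x xd Ex] := disc_coset_surj c.
have [z Ez] := (dualE x).1 xd.
pose w := z *m \adj M.
have xw : x = (d%:~R)^-1 *: (map_mx intr w *m B).
  apply: (can_inj (mulmxK Tu)); rewrite Ez -scalemxAl -mulmxA EM -map_mxM.
  by rewrite -mulmxA mul_adj_mx mul_mx_scalar map_mxZ scalerA mulVf // scale1r.
clearbody w; pose wk k : int := w 0 k.
have wlt k : (`|(wk k %% d)%Z|%N < `|d|%N)%N.
  by rewrite -ltz_nat gez0_abs ?modz_ge0 // abszE ltz_mod.
pose w' : 'rV['I_`|d|%N]_n := \row_k Ordinal (wlt k).
exists w' => //; rewrite -Ex /f.
set y := _ *: _.
have yxN : x - y \in lat N.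
  apply/NB; exists (\row_k (wk k %/ d)%Z).
  rewrite xw -scalerBr -mulmxBl scalemxAl; congr (_ *m _).
  apply/rowP => k; rewrite !mxE -/(wk k).
  have /= -> : (`|(wk k %% d)%Z|%N)%:R = (wk k %% d)%Z%:~R :> rat.
    by rewrite -[in RHS](gez0_abs (modz_ge0 _ d0)).
  rewrite {1}(divz_eq (wk k) d) intrD addrK intrM mulrC mulfK //.
apply/esym/coset_perp_eq => //.
rewrite -[y](subKr x); apply: rpredB => //; exact: lat_sub_dual.
Qed.
End DiscFinite.

Section Reduction.
Variables (n : nat) (S : quadSpace n) (L M : evenLattice S) (D : quadMod).
Variable H : isotropic (dsum (disc L) D).

Definition horizontal : Prop :=
  (forall a : disc L, ((a, 0) : dsum (disc L) D) \in iso_sub H -> a = 0) /\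
  (forall b : D, ((0, b) : dsum (disc L) D) \in iso_sub H -> b = 0).

(* the subgroup M/L of D_L *)
Definition over_sub : set (disc L) :=
  [set disc_coset L x | x in [set x | x \in lat M /\ x \in dual_lattice L]].

(* image of M/L under H_L ~ H ~ H_D when M/L is contained in H_L *)
Definition I_pred : {pred D} := fun d =>
  `[< exists g : dsum (disc L) D, [/\ g \in iso_sub H, over_sub g.1 & g.2 = d] >].

Lemma I_zmod_closed : zmod_closed I_pred.
Proof.
split=> [|d e /asboolP[g [gH [x [xM xL] gx] <-]] /asboolP[h [hH [y [yM yL] hy] <-]]].
  apply/asboolP; exists 0; split; rewrite ?rpred0 //.
  by exists 0; [split; exact: rpred0 | exact: coset_perp0].
apply/asboolP; exists (g - h); split; rewrite ?rpredB //.
exists (x - y); first by split; exact: rpredB.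
by rewrite /disc_coset coset_perpB // -/(disc_coset L x) -/(disc_coset L y) gx hy.
Qed.

HB.instance Definition _ := GRing.isZmodClosed.Build D I_pred I_zmod_closed.

Lemma I_qform0 d : d \in I_pred -> qform d = 0.
Proof.
case/asboolP=> g [gH [x [xM xL] gx] <-].
have := iso_qform0 gH; rewrite dsum_qformE -gx coset_perp_qE //.
by rewrite (lat_qform0 xM) add0r.
Qed.

Definition I_iso : isotropic D := @Isotropic D I_pred I_qform0.

(* c is the image of g under g |-> (g_L + I_L, g_D + I), the class g_L + I_L
   being read in M^*/M through a representative x of g_L lying in M^*. *)
Definition reduces (g : dsum (disc L) D) (c : dsum (disc M) (perp_quot I_iso)) :=
  exists x : 'rV[rat]_n,
    [/\ x \in dual_lattice L, x \in dual_lattice M, disc_coset L x = g.1,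
        g.2 \in perp I_iso & c = (disc_coset M x, coset_perp I_iso g.2)].

(* (H cap I^perp)/I_H, as its image in D_M (+) I^perp/I *)
Definition Hbar_pred : {pred dsum (disc M) (perp_quot I_iso)} := fun c =>
  `[< exists2 g : dsum (disc L) D, g \in iso_sub H & reduces g c >].

Lemma Hbar_zmod_closed : zmod_closed Hbar_pred.
Proof.
split=> [|c d /asboolP[g gH [x [xL xM gx gI ->]]]
              /asboolP[h hH [y [yL yM hy hI ->]]]].
  apply/asboolP; exists 0; first exact: rpred0.
  exists 0; split; rewrite ?rpred0 //; first exact: coset_perp0.
  by rewrite /disc_coset !coset_perp0.
apply/asboolP; exists (g - h); first exact: rpredB.
exists (x - y); split; rewrite ?rpredB //.
  by rewrite /disc_coset coset_perpB // -/(disc_coset L x) -/(disc_coset L y) gx hy.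
by rewrite /disc_coset !coset_perpB.
Qed.

HB.instance Definition _ :=
  GRing.isZmodClosed.Build (dsum (disc M) (perp_quot I_iso)) Hbar_pred
    Hbar_zmod_closed.

Lemma Hbar_qform0 c : c \in Hbar_pred -> qform c = 0.
Proof.
case/asboolP=> g gH [x [xL xM gx gI ->]].
have := iso_qform0 gH.
by rewrite !dsum_qformE -gx /disc_coset !coset_perp_qE.
Qed.

Definition Hbar : isotropic (dsum (disc M) (perp_quot I_iso)) :=
  @Isotropic (dsum (disc M) (perp_quot I_iso)) Hbar_pred Hbar_qform0.

(* graph of the partial map p *)
Definition p_rel (b : perp_quot H) (a : perp_quot Hbar) : Prop :=
  exists g c, [/\ g \in perp H, coset_perp H g = b, reduces g c,
                  c \in perp Hbar & coset_perp Hbar c = a].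

End Reduction.

(* C[E] as the space of functions E -> C. This, and the sums over subsets of E
   below, are only used for finite E (see [disc_discriminant_form] for D_N);
   [\sum_(_ \in _)] is 0 by convention when the support is infinite. *)
Definition galg (R : realType) (E : quadMod) := E -> R[i].

Section GroupAlgebra.
Variable R : realType.

Definition ebasis (E : quadMod) (g : E) : galg R E := fun x => (x == g)%:R.

Definition linext (E E' : quadMod) (u : E -> galg R E') (f : galg R E) :
    galg R E' :=
  fun y => \sum_(g \in [set: E]) f g * u g y.

Definition esetsum (E : quadMod) (A : set E) : galg R E :=
  fun x => \sum_(d \in A) ebasis d x.

Definition up (E : quadMod) (Y : isotropic E) :
    galg R (perp_quot Y) -> galg R E :=
  linext (fun g => esetsum [set d | d \in perp Y /\ coset_perp Y d = g]).

Definition down (E : quadMod) (Y : isotropic E) :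
    galg R E -> galg R (perp_quot Y) :=
  linext (fun d => if d \in perp Y then ebasis (coset_perp Y d) else fun=> 0).

Definition tensor (A B : quadMod) (f : galg R A) (g : galg R B) :
    galg R (dsum A B) :=
  fun x => f x.1 * g x.2.

Definition calP (n : nat) (S : quadSpace n) (L M : evenLattice S)
    (D : quadMod) (H : isotropic (dsum (disc L) D)) :
    galg R (perp_quot (Hbar M H)) -> galg R (perp_quot H) :=
  linext (fun a => esetsum [set b | p_rel b a]).

End GroupAlgebra.

Arguments up {R E} Y f _.
Arguments down {R E} Y f _.
Arguments calP {R n S L} M {D} H f _.

Section Analysis.
Variable R : realType.

Definition upper_half := {tau : R[i] | 0 < complex.Im tau}.

Definition cexp (z : R[i]) : R[i] :=
  (expR (complex.Re z))%:C%C * (cos (complex.Im z) +i* sin (complex.Im z))%C.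

Definition ee (z : R[i]) : R[i] := cexp (2 * (pi : R)%:C%C * 'i%C * z).

(* positive part minus negative part: the unconditional sum of an absolutely
   summable family *)
Definition rsum (T : choiceType) (A : set T) (f : T -> R) : R :=
  fine (\esum_(x in A) (EFin \o f)^\+%E x) -
  fine (\esum_(x in A) (EFin \o f)^\-%E x).

Definition csum (T : choiceType) (A : set T) (f : T -> R[i]) : R[i] :=
  (rsum A (fun x => complex.Re (f x)) +i* rsum A (fun x => complex.Im (f x)))%C.

(* C^k on U, through continuity of all iterated partial derivatives *)
Fixpoint Ck (k : nat) (U : set (R^o * R^o)%type) (g : (R^o * R^o)%type -> R^o)
    : Prop :=
  match k with
  | 0 => forall p, U p -> {for p, continuous g}
  | j.+1 => [/\ forall p, U p -> {for p, continuous g} /\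
                  derivable g p (1, 0) /\ derivable g p (0, 1),
                Ck j U (fun p => 'D_(1, 0) g p) &
                Ck j U (fun p => 'D_(0, 1) g p)]
  end.

Definition smooth_real (f : upper_half -> R) : Prop :=
  forall k, Ck k [set p | 0 < p.2]
    (fun p => oapp f 0 (insub (p.1 +i* p.2)%C : option upper_half)).

Definition smooth (E : quadMod) (F : upper_half -> galg R E) : Prop :=
  forall g : E, smooth_real (fun tau => complex.Re (F tau g)) /\
                smooth_real (fun tau => complex.Im (F tau g)).

Section Theta.
Variables (n : nat) (S : quadSpace n).

Definition gramR : 'M[R]_n := map_mx ratr S.
Definition gramC : 'M[R[i]]_n := map_mx ratr S.

Definition toR (x : 'rV[rat]_n) : 'rV[R]_n := map_mx ratr x.
Definition toC (x : 'rV[rat]_n) : 'rV[R[i]]_n := map_mx ratr x.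

Record splitting := Splitting {
  vpos : {vspace 'rV[R]_n};
  vneg : {vspace 'rV[R]_n};
  split_sum : (vpos + vneg = fullv)%VS;
  split_cap : (vpos :&: vneg = 0)%VS;
  split_orth : forall x y, x \in vpos -> y \in vneg -> bil gramR x y = 0;
  split_pos : forall x, x \in vpos -> x != 0 -> 0 < bil gramR x x;
  split_neg : forall x, x \in vneg -> x != 0 -> bil gramR x x < 0
}.

Definition has_signature (bp bm : nat) : Prop :=
  exists v : splitting, \dim (vpos v) = bp /\ \dim (vneg v) = bm.

Variable v : splitting.

Definition projp (x : 'rV[R]_n) : 'rV[R]_n := daddv_pi (vpos v) (vneg v) x.
Definition projm (x : 'rV[R]_n) : 'rV[R]_n := daddv_pi (vneg v) (vpos v) x.

Definition gauss (tau : upper_half) (x : 'rV[rat]_n) : R[i] :=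
  val tau * (bil gramR (projp (toR x)) (projp (toR x)) / 2)%:C%C +
  (val tau)^*%C * (bil gramR (projm (toR x)) (projm (toR x)) / 2)%:C%C.

Definition theta (N : evenLattice S) (tau : upper_half) (zeta : 'rV[R[i]]_n) :
    galg R (disc N) :=
  fun g => csum [set x | x \in dual_lattice N /\ disc_coset N x = g]
    (fun x => ee (gauss tau x + bil gramC (toC x) zeta)).
Arguments theta N tau zeta _ : clear implicits.

Definition Phi (N : evenLattice S) (D : quadMod)
    (H : isotropic (dsum (disc N) D)) (F : upper_half -> galg R D)
    (tau : upper_half) (zeta : 'rV[R[i]]_n) : galg R (perp_quot H) :=
  down H (tensor (theta N tau zeta) (F tau)).
Arguments Phi {N D} H F tau zeta _.

Definition elliptic_shift (tau : upper_half) (zeta : 'rV[R[i]]_n)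
    (s nu : 'rV[rat]_n) : 'rV[R[i]]_n :=
  zeta + val tau *: map_mx (real_complex R) (projp (toR s))
       + (val tau)^*%C *: map_mx (real_complex R) (projm (toR s)) + toC nu.

End Theta.
End Analysis.

Arguments theta {R n S} v N tau zeta _.
Arguments Phi {R n S} v {N D} H F tau zeta _.

(* Main.v *)
(** Expand each component of [Phi] as a series over the vectors x of the dual
    lattice, with terms A(x) e(gauss x + (x, zeta)).  It converges absolutely, and
    an absolutely convergent series of exponentials that vanishes at all rational
    points has zero coefficients, so the transformation law under (s, nu) becomes
    A(x - s) e((x - s, nu)) = A(x).  As H is horizontal, A(x) is a single value
    F(d) with (x + L, d) orthogonal to H, and every d in D occurs in this way.
    With s = 0 the identity says that F is supported on the orthogonal of I, with
    nu = 0 that F is invariant under I; hence F is lifted from a unique G.  The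
    formula for [Phi] then holds coefficient by coefficient, because x lies in the
    dual of Lambda exactly when d is orthogonal to I. *)

Require Import Defs.
From HB Require Import structures.
From mathcomp Require Import all_boot all_order all_algebra.
From mathcomp Require Import ring_quotient complex ring lra.
From mathcomp Require Import all_classical all_reals all_analysis.

Set Implicit Arguments.
Unset Strict Implicit.
Unset Printing Implicit Defensive.

Import Order.TTheory GRing.Theory Num.Theory.
Import numFieldNormedType.Exports.

Local Open Scope classical_set_scope.
Local Open Scope ring_scope.

(** * Unconditional sums *)

Section RealSums.
Variables (R : realType) (T : choiceType).
Implicit Types (f g p q : T -> R).

(** Coefficients are compared without integrating over a torus. Frequencies range over all of Q^n,
    with coefficient 0 off the dual lattice, and shifts of zeta by rational vectors already separate
    them: for x different from x0, nondegeneracy yields nu with (x - x0, nu) = 1/2, and the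
    character value -1 cancels the term at x in an average. As the form is indefinite, absolute
    convergence comes from the majorant x_+^2 - x_-^2 and not from the form itself. On the algebraic
    side one congruence does the work. If y in Lambda and i in I are partners, that is (y + L, i)
    lies in H, then orthogonality of (x + L, d) to H gives (x, y) = -(d, i) mod Z. It turns the
    character e((x, nu)) of the transformation law into a character of d, and it matches the dual of
    Lambda with the orthogonal of I. The delicate half of the last comparison is the converse one: a
    vector contributing over Lambda must contribute over L to the corresponding component, which
    requires correcting a lift from the reduced group by an element of I_H. *)

Definition rsummable f := summable [set: T] (EFin \o f).

Lemma rsummable_le f g : rsummable g -> (forall x, `|f x| <= `|g x|) ->
  rsummable f.
Proof.
move=> sg fg; apply: le_lt_trans sg.
by apply: le_esum => x _ /=; rewrite lee_fin.
Qed.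

Lemma rsummableD f g : rsummable f -> rsummable g ->
  rsummable (fun x => f x + g x).
Proof. exact: summableD. Qed.

Lemma rsummable_esum p : rsummable p -> (forall x, 0 <= p x) ->
  (\esum_(x in [set: T]) (p x)%:E)%E \is a fin_num.
Proof.
rewrite /rsummable summableE => sp p0; rewrite (eq_esum (b := abse \o (EFin \o p))) //.
by move=> x _ /=; rewrite ger0_norm.
Qed.

(** Positive and negative parts are not additive in f. This lemma frees [rsum] from them: any
    writing of f as a difference of summable non-negative families computes the sum, and linearity
    follows. *)
Lemma rsum_diff p q : rsummable p -> rsummable q ->
  (forall x, 0 <= p x) -> (forall x, 0 <= q x) ->
  rsum [set: T] (fun x => p x - q x) =
  fine (\esum_(x in [set: T]) (p x)%:E) - fine (\esum_(x in [set: T]) (q x)%:E).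
Proof.
move=> sp sq p0 q0.
have sd : summable [set: T] (EFin \o (fun x => p x - q x)).
  apply: le_lt_trans (lte_add_pinfty sp sq); rewrite -esumD//; apply: le_esum => x _ /=.
  by rewrite lee_fin ler_normB.
have := @esumB R T [set: T] (EFin \o p) (EFin \o q) sp sq.
move=> /(_ (fun x _ => p0 x))/(_ (fun x _ => q0 x)) Epq.
have fin1 : (\esum_(i in [set: T]) ((EFin \o p) \- (EFin \o q))^\+ i)%E \is a fin_num.
  have := summable_funepos sd; rewrite summableE; congr (_ \is a fin_num).
  by apply: eq_esum => x _; rewrite gee0_abs.
have fin2 : (\esum_(i in [set: T]) ((EFin \o p) \- (EFin \o q))^\- i)%E \is a fin_num.
  have := summable_funeneg sd; rewrite summableE; congr (_ \is a fin_num).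
  by apply: eq_esum => x _; rewrite gee0_abs.
rewrite -!fineB ?rsummable_esum // -[in RHS]Epq /rsum fineB //.
Qed.

Lemma rsumE f : rsummable f -> exists p q, [/\ rsummable p, rsummable q,
  forall x, 0 <= p x, forall x, 0 <= q x & forall x, f x = p x - q x].
Proof.
move=> sf; exists (fun x => Num.max (f x) 0), (fun x => Num.max (- f x) 0).
have bnd x : [/\ 0 <= Num.max (f x) 0 <= `|f x|, 0 <= Num.max (- f x) 0 <= `|f x| &
    f x = Num.max (f x) 0 - Num.max (- f x) 0].
  have [f0|f0] := lerP 0 (f x).
    rewrite ger0_norm //.
    have -> : Num.max (- f x) 0 = 0 by apply: max_r; rewrite oppr_le0.
    by split; lra.
  rewrite ltr0_norm //.
  have -> : Num.max (- f x) 0 = - f x by apply: max_l; rewrite oppr_ge0 ltW.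
  by split; lra.
split=> [||x|x|x]; do ?[apply: rsummable_le sf _ => x].
- by case: (bnd x) => /andP[h1 h2] _ _; rewrite ger0_norm.
- by case: (bnd x) => _ /andP[h1 h2] _; rewrite ger0_norm.
- by case: (bnd x) => /andP[].
- by case: (bnd x) => _ /andP[].
- by case: (bnd x).
Qed.

Lemma eq_rsum (A : set T) f g : (forall x, A x -> f x = g x) -> rsum A f = rsum A g.
Proof.
move=> fg; rewrite /rsum; congr (fine _ - fine _); apply: eq_esum => x Ax.
  by rewrite !funeposE /= fg.
by rewrite !funenegE /= fg.
Qed.

Lemma rsum_mkcond (A : set T) f :
  rsum A f = rsum [set: T] (fun x => if x \in A then f x else 0).
Proof.
rewrite /rsum esum_mkcond; congr (fine _ - fine _).
  by apply: eq_esum => x _; rewrite !funeposE /=; case: ifP; rewrite ?maxxx.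
rewrite esum_mkcond.
by apply: eq_esum => x _; rewrite !funenegE /=; case: ifP; rewrite ?oppr0 ?maxxx.
Qed.

Lemma rsumD f g : rsummable f -> rsummable g ->
  rsum [set: T] (fun x => f x + g x) = rsum [set: T] f + rsum [set: T] g.
Proof.
move=> /rsumE[p [q [sp sq p0 q0 fE]]] /rsumE[p' [q' [sp' sq' p0' q0' gE]]].
under [in LHS]eq_rsum => x _ do rewrite fE gE.
rewrite (eq_rsum (f := f) (fun x _ => fE x)) (eq_rsum (f := g) (fun x _ => gE x)).
rewrite (@eq_rsum _ _ (fun x => (p x + p' x) - (q x + q' x))); last by move=> x _; lra.
rewrite !rsum_diff //; try exact: rsummableD; try by move=> x; rewrite addr_ge0.
under eq_esum do rewrite EFinD.
under [X in _ - fine X]eq_esum do rewrite EFinD.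
rewrite !esumD // ?fineD ?rsummable_esum //; try by move=> x _; rewrite lee_fin.
lra.
Qed.

Lemma rsumN f : rsummable f ->
  rsum [set: T] (fun x => - f x) = - rsum [set: T] f.
Proof.
move=> /rsumE[p [q [sp sq p0 q0 fE]]].
rewrite (eq_rsum (f := f) (fun x _ => fE x)) rsum_diff // opprB -rsum_diff //.
by apply: eq_rsum => x _; rewrite fE; lra.
Qed.

Lemma ge0_esumZl (a : R) p : 0 <= a ->
  (\esum_(x in [set: T]) (a * p x)%:E = a%:E * \esum_(x in [set: T]) (p x)%:E)%E.
Proof.
move=> a0; rewrite /esum -ereal_supZl //; last first.
  by apply/set0P; exists 0%E; exists set0; [exact: fsets_set0 | rewrite fsbig_set0].
congr ereal_sup; rewrite image_comp; apply: eq_imagel => A [finA _] /=.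
by rewrite !fsbig_finite // !sumEFin -EFinM mulr_sumr.
Qed.

Lemma rsummableZ (a : R) f : rsummable f -> rsummable (fun x => a * f x).
Proof.
move=> sf; rewrite /rsummable /summable.
under eq_esum do rewrite /= normrM.
rewrite ge0_esumZl ?normr_ge0 // lte_mul_pinfty ?lee_fin ?normr_ge0 //.
Qed.

Lemma rsumZ (a : R) f : rsummable f ->
  rsum [set: T] (fun x => a * f x) = a * rsum [set: T] f.
Proof.
wlog a0 : a / 0 <= a => [hw|].
  move=> sf; have [a0|/ltW a0] := lerP 0 a; first exact: hw.
  rewrite (@eq_rsum _ _ (fun x => - (- a * f x))); last by move=> x _; lra.
  by rewrite rsumN ?hw ?oppr_ge0 ?mulNr ?opprK //; exact: rsummableZ.
move=> /rsumE[p [q [sp sq p0 q0 fE]]].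
rewrite (eq_rsum (f := f) (fun x _ => fE x)).
rewrite (@eq_rsum _ _ (fun x => a * p x - a * q x)); last first.
  by move=> x _; rewrite fE mulrBr.
rewrite !rsum_diff //; try exact: rsummableZ; try by move=> x; rewrite mulr_ge0.
by rewrite !ge0_esumZl // !fineM ?rsummable_esum // mulrBr.
Qed.

(** Both p + f and p - f are non-negative, hence so are their sums. *)
Lemma rsum_norm_le f p : rsummable p -> (forall x, `|f x| <= p x) ->
  `|rsum [set: T] f| <= fine (\esum_(x in [set: T]) (p x)%:E).
Proof.
move=> sp fp.
have p0 x : 0 <= p x by apply: le_trans (fp x).
have sf : rsummable f by apply: rsummable_le sp _ => x; rewrite (ger0_norm (p0 x)).
have pos g : rsummable g -> (forall x, 0 <= g x) -> 0 <= rsum [set: T] g.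
  move=> sg g0; rewrite (@eq_rsum _ _ (fun x => g x - 0)); last first.
    by move=> x _; rewrite subr0.
  have s0 : rsummable (fun=> 0) by apply: rsummable_le sg _ => x; rewrite normr0.
  rewrite rsum_diff // [X in _ - fine X]esum1 // subr0 fine_ge0 //.
  by apply: esum_ge0 => x _; rewrite lee_fin.
have -> : fine (\esum_(x in [set: T]) (p x)%:E)%E = rsum [set: T] p.
  have s0 : rsummable (fun=> 0) by apply: rsummable_le sp _ => x; rewrite normr0.
  rewrite -[RHS](@eq_rsum _ (fun x => p x - 0)); last by move=> x _; rewrite subr0.
  by rewrite rsum_diff // [X in _ = _ - fine X]esum1 // subr0.
have h1 : 0 <= rsum [set: T] p + rsum [set: T] f.
  rewrite -rsumD //; apply: pos => [|x]; first exact: rsummableD.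
  by have := fp x; rewrite ler_norml => /andP[]; lra.
have sNf : rsummable (fun x => - f x) by apply: rsummable_le sf _ => x; rewrite normrN.
have h2 : 0 <= rsum [set: T] p - rsum [set: T] f.
  rewrite -rsumN // -rsumD //; apply: pos => [|x]; first exact: rsummableD.
  by have := fp x; rewrite ler_norml => /andP[]; lra.
by rewrite ler_norml; lra.
Qed.

Lemma rsum_reindex (e : T -> T) f : bijective e ->
  rsum [set: T] f = rsum [set: T] (f \o e).
Proof.
rewrite -setTT_bijective => be; rewrite /rsum.
rewrite (reindex_esum [set: T] [set: T] e (EFin \o f)^\+%E) //.
rewrite (reindex_esum [set: T] [set: T] e (EFin \o f)^\-%E) //.
congr (fine _ - fine _); apply: eq_esum => x _; first by rewrite !funeposE.
by rewrite !funenegE.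
Qed.

Lemma rsum_single x0 f : (forall x, x != x0 -> f x = 0) -> rsum [set: T] f = f x0.
Proof.
move=> f0.
rewrite (@eq_rsum _ _ (fun x => if x \in [set x0] then f x else 0)); last first.
  move=> x _; case: ifPn => //; rewrite notin_setE /= => /eqP; exact: f0.
rewrite -rsum_mkcond /rsum !esum_set1 ?funepos_ge0 ?funeneg_ge0 // -fineB //.
- by rewrite -[X in fine X]/((_ \- _)%E x0) -funeposneg.
- by rewrite funeposE /= -EFin_max.
- by rewrite funenegE /= -EFin_max.
Qed.

End RealSums.

Section ComplexSums.
Variables (R : realType) (T : choiceType).
Implicit Types (f g : T -> R[i]).
Local Notation normc := ComplexField.Normc.normc.

(** The modulus is taken as [normc], which is real-valued, whereas the norm of [R[i]] takes values
    in [R[i]]. *)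
Definition csummable f := rsummable (fun x => normc (f x)).

Lemma normc_ge0 (z : R[i]) : 0 <= normc z.
Proof. by case: z => a b; exact: sqrtr_ge0. Qed.

Lemma normc_ge_Re_Im (z : R[i]) :
  `|complex.Re z| <= normc z /\ `|complex.Im z| <= normc z.
Proof.
case: z => a b /=; split; rewrite -sqrtr_sqr ler_sqrt ?addr_ge0 ?sqr_ge0 //.
  by rewrite lerDl sqr_ge0.
by rewrite lerDr sqr_ge0.
Qed.

Lemma csummable_le f g : csummable g -> (forall x, normc (f x) <= normc (g x)) ->
  csummable f.
Proof.
by move=> sg fg; apply: rsummable_le sg _ => x; rewrite !ger0_norm ?normc_ge0.
Qed.

Lemma csummable_Re f : csummable f -> rsummable (fun x => complex.Re (f x)).
Proof.
move=> sf; apply: rsummable_le sf _ => x; rewrite [leRHS]ger0_norm ?normc_ge0 //.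
by case: (normc_ge_Re_Im (f x)).
Qed.

Lemma csummable_Im f : csummable f -> rsummable (fun x => complex.Im (f x)).
Proof.
move=> sf; apply: rsummable_le sf _ => x; rewrite [leRHS]ger0_norm ?normc_ge0 //.
by case: (normc_ge_Re_Im (f x)).
Qed.

Lemma csummableD f g : csummable f -> csummable g ->
  csummable (fun x => f x + g x).
Proof.
move=> sf sg; apply: rsummable_le (rsummableD sf sg) _ => x.
rewrite !ger0_norm ?addr_ge0 ?normc_ge0 //.
exact: (@le_normcD R).
Qed.

Lemma csummableZ (a : R[i]) f : csummable f -> csummable (fun x => a * f x).
Proof.
move=> sf; apply: rsummable_le (rsummableZ (normc a) sf) _ => x.
by rewrite ComplexField.Normc.normcM.
Qed.

Lemma eq_csum (A : set T) f g : (forall x, A x -> f x = g x) -> csum A f = csum A g.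
Proof. by move=> fg; congr (_ +i* _)%C; apply: eq_rsum => x Ax; rewrite fg. Qed.

Lemma csum_mkcond (A : set T) f :
  csum A f = csum [set: T] (fun x => if x \in A then f x else 0).
Proof.
congr (_ +i* _)%C; rewrite rsum_mkcond; apply: eq_rsum => x _; by case: ifP.
Qed.

Lemma csumD f g : csummable f -> csummable g ->
  csum [set: T] (fun x => f x + g x) = csum [set: T] f + csum [set: T] g.
Proof.
move=> sf sg; rewrite /csum.
rewrite -[RHS]/(_ +i* _)%C -rsumD; try exact: csummable_Re.
rewrite -rsumD; try exact: csummable_Im.
by congr (_ +i* _)%C; apply: eq_rsum => x _; case: (f x) (g x) => [? ?] [? ?].
Qed.

Lemma csumZ (a : R[i]) f : csummable f ->
  csum [set: T] (fun x => a * f x) = a * csum [set: T] f.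
Proof.
move=> sf; case: a => a b; rewrite /csum -[RHS]/(_ +i* _)%C.
have sRe := csummable_Re sf; have sIm := csummable_Im sf.
have sN : rsummable (fun x => - (b * complex.Im (f x))).
  by apply: rsummable_le (rsummableZ b sIm) _ => x; rewrite normrN.
have -> : a * rsum [set: T] (fun x => complex.Re (f x)) -
    b * rsum [set: T] (fun x => complex.Im (f x)) =
    rsum [set: T] (fun x => complex.Re ((a +i* b)%C * f x)).
  rewrite -!rsumZ // -rsumN; last exact: rsummableZ.
  rewrite -rsumD //; last exact: rsummableZ.
  by apply: eq_rsum => x _; case: (f x).
rewrite -!rsumZ // -rsumD; [|exact: rsummableZ|exact: rsummableZ].
by congr (_ +i* _)%C; apply: eq_rsum => x _; case: (f x).
Qed.

Lemma csummable0 : csummable (fun=> 0 : R[i]).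
Proof.
rewrite /csummable /rsummable /summable esum1 // => x _ /=.
by rewrite expr0n /= addr0 sqrtr0 normr0.
Qed.

Lemma csum0 : csum [set: T] (fun=> 0 : R[i]) = 0.
Proof.
rewrite -[RHS](mul0r (csum [set: T] (fun=> 0))) -csumZ; last exact: csummable0.
by apply: eq_csum => x _; rewrite mul0r.
Qed.

Lemma csummable_sum (I : Type) (r : seq I) (h : I -> T -> R[i]) :
  (forall i, csummable (h i)) -> csummable (fun x => \sum_(i <- r) h i x).
Proof.
move=> sh; elim: r => [|i r IHr].
  by under [X in csummable X]eq_fun do rewrite big_nil; exact: csummable0.
under [X in csummable X]eq_fun do rewrite big_cons.
exact: csummableD.
Qed.

Lemma csum_sum (I : Type) (r : seq I) (h : I -> T -> R[i]) :
  (forall i, csummable (h i)) ->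
  csum [set: T] (fun x => \sum_(i <- r) h i x) = \sum_(i <- r) csum [set: T] (h i).
Proof.
move=> sh; elim: r => [|i r IHr].
  by rewrite [RHS]big_nil -[RHS]csum0; apply: eq_csum => x _; rewrite big_nil.
rewrite big_cons -IHr -csumD //; last exact: csummable_sum.
by apply: eq_csum => x _; rewrite big_cons.
Qed.

Lemma csum_reindex (e : T -> T) f : bijective e ->
  csum [set: T] f = csum [set: T] (f \o e).
Proof. by move=> be; congr (_ +i* _)%C; rewrite (rsum_reindex _ be). Qed.

Lemma csum_single x0 f : (forall x, x != x0 -> f x = 0) -> csum [set: T] f = f x0.
Proof.
move=> f0; rewrite /csum !(@rsum_single _ _ x0); first by case: (f x0).
  by move=> x /f0 ->.
by move=> x /f0 ->.
Qed.

Lemma csum_Re_Im_le f (p : T -> R) (z := csum [set: T] f) :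
  rsummable p -> (forall x, normc (f x) <= p x) ->
  `|complex.Re z| <= fine (\esum_(x in [set: T]) (p x)%:E) /\
  `|complex.Im z| <= fine (\esum_(x in [set: T]) (p x)%:E).
Proof.
move=> sp fp; split; apply: rsum_norm_le => // x; apply: le_trans (fp x);
  by case: (normc_ge_Re_Im (f x)).
Qed.

End ComplexSums.

(** * The exponential and the characters of Q/Z *)

Section Exponential.
Variable R : realType.
Implicit Types z w : R[i].
Local Notation normc := ComplexField.Normc.normc.

Lemma eeE z : ee z = (expR (- (2 * pi * complex.Im z)))%:C%C *
  (cos (2 * pi * complex.Re z) +i* sin (2 * pi * complex.Re z))%C.
Proof.
case: z => a b; rewrite /ee /cexp.
have -> : 2 * (pi : R)%:C%C * 'i%C * (a +i* b)%C =
    ((- (2 * pi * b)) +i* (2 * pi * a))%C :> R[i].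
  have -> : (2 : R[i]) = (2 : R)%:C%C by rewrite rmorph_nat.
  by apply/eqP; rewrite eq_complex /=; apply/andP; split; apply/eqP; ring.
by [].
Qed.

Lemma eeD z w : ee (z + w) = ee z * ee w.
Proof.
case: z w => [a b] [c d]; rewrite !eeE /= !mulrDr opprD expRD cosD sinD.
by apply/eqP; rewrite eq_complex /=; apply/andP; split; apply/eqP; ring.
Qed.

Lemma ee0 : ee 0 = 1 :> R[i].
Proof.
rewrite eeE /= !mulr0 oppr0 expR0 cos0 sin0.
by apply/eqP; rewrite eq_complex /=; apply/andP; split; apply/eqP; ring.
Qed.

Lemma eeN z : ee z * ee (- z) = 1.
Proof. by rewrite -eeD subrr ee0. Qed.

Lemma ee_neq0 z : ee z != 0.
Proof.
by apply: contra_eq_neq (eeN z) => ->; rewrite mul0r eq_sym oner_neq0.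
Qed.

Lemma normc_ee z : normc (ee z) = expR (- (2 * pi * complex.Im z)).
Proof.
rewrite eeE ComplexField.Normc.normcM /= cos2Dsin2 sqrtr1 mulr1.
by rewrite expr0n addr0 sqrtr_sqr ger0_norm // expR_ge0.
Qed.

Definition chi (r : rat) : R[i] := ee (ratr r).

Lemma ratr_complex (r : rat) : ratr r = (ratr r : R)%:C%C :> R[i].
Proof. by rewrite fmorph_rat. Qed.

Lemma chiD r s : chi (r + s) = chi r * chi s.
Proof. by rewrite /chi rmorphD eeD. Qed.

Lemma chi0 : chi 0 = 1. Proof. by rewrite /chi rmorph0 ee0. Qed.

Lemma normc_chi r : normc (chi r) = 1.
Proof. by rewrite /chi normc_ee ratr_complex /= mulr0 oppr0 expR0. Qed.

Lemma chi_half : chi (2^-1) = -1.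
Proof.
have half : ratr 2^-1 = 2^-1 :> R by rewrite fmorphV rmorph_nat.
rewrite /chi ratr_complex half eeE /= mulr0 oppr0 expR0.
have -> : 2 * pi * 2^-1 = pi :> R by lra.
rewrite cospi sinpi.
by apply/eqP; rewrite eq_complex /=; apply/andP; split; apply/eqP; ring.
Qed.

Lemma chi1 : chi 1 = 1.
Proof.
have {1}-> : 1 = 2^-1 + 2^-1 :> rat by [].
by rewrite chiD chi_half mulrNN mulr1.
Qed.

Lemma chi_int r : r \is a Num.int -> chi r = 1.
Proof.
have chi_nat m : chi m%:R = 1.
  by elim: m => [|m IHm]; [exact: chi0 | rewrite -addn1 natrD chiD IHm chi1 mulr1].
case/intrP => -[m|m] ->; first by rewrite -pmulrn.
rewrite NegzE mulrNz -pmulrn; have := chi_nat m.+1.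
by move=> h; rewrite -[LHS]mul1r -h -chiD subrr chi0.
Qed.

(** For a fractional part f in (0, 1) the real part cos(2 pi f) = 1 - 2 sin(pi f)^2 is less than
    1. *)
Lemma chi_eq1 r : chi r = 1 -> r \is a Num.int.
Proof.
have [f [f0 f1 fr]] : exists f : rat, [/\ 0 <= f, f < 1 & r - f \is a Num.int].
  exists (r - (Num.floor r)%:~R); split.
  - by rewrite subr_ge0 ge_floor.
  - by rewrite ltrBlDl -[1]/(1%:~R) -rmorphD /= floorD1_gt.
  - by rewrite opprB addrC subrK intr_int.
rewrite -(subrK f r) chiD chi_int // mul1r rpredDl // => {fr}.
move: f0; rewrite le_eqVlt => /predU1P[<-|f0]; first by rewrite rpred0.
rewrite /chi ratr_complex eeE /= mulr0 oppr0 expR0 => /eqP.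
rewrite eq_complex /= => /andP[/eqP]; rewrite mul0r subr0 mul1r.
have -> : 2 * pi * ratr f = (pi * ratr f) *+ 2 :> R by rewrite mulr2n; ring.
rewrite cos_mulr2n cos2sin2.
have : 0 < sin (pi * ratr f : R).
  apply: sin_gt0_pi; rewrite mulr_gt0 ?pi_gt0 ?ltr0q //=.
  by rewrite gtr_pMr ?pi_gt0 // -(rmorph1 (ratr : {rmorphism rat -> R})) ltr_rat.
move=> /(exprn_gt0 2) s0 h _; exfalso; move: s0 h.
by set t := sin _ ^+ 2; lra.
Qed.

(** The representative is arbitrary; [chiQE] shows that it does not matter, since [chi] is trivial
    on Z. *)
Definition chiQ (c : QmodZ) : R[i] := chi (repr c).

Lemma chiQE r : chiQ (toQmodZ r) = chi r.
Proof.
rewrite /chiQ /toQmodZ; set s := repr _.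
have : s - r \in intQ by rewrite Quotient.idealrBE reprK.
by move=> h; rewrite -(subrK r s) chiD chi_int ?mul1r.
Qed.

Lemma chiQD c d : chiQ (c + d) = chiQ c * chiQ d.
Proof.
rewrite -[c]reprK -[d]reprK -!/(toQmodZ _) !chiQE -chiD -chiQE.
by rewrite /toQmodZ raddfD.
Qed.

Lemma chiQ0 : chiQ 0 = 1.
Proof. by rewrite -chi0 -chiQE /toQmodZ raddf0. Qed.

Lemma chiQ_eq1 c : chiQ c = 1 -> c = 0.
Proof. by rewrite -[c]reprK -/(toQmodZ _) chiQE => /chi_eq1 /toQmodZ_eq0. Qed.

End Exponential.

(** The sum is the supremum of its finite partial sums, and one of them comes within e of it. In the
    Fourier argument this leaves only finitely many coefficients to be killed exactly. *)
Lemma rsummable_tail (R : realType) (T : choiceType) (p : T -> R) (e : R) :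
  rsummable p -> (forall x, 0 <= p x) -> 0 < e ->
  exists2 A : set T, finite_set A &
    fine (\esum_(x in [set: T]) (if x \in A then 0 else p x)%:E) <= e.
Proof.
move=> sp p0 e0; have sfin := rsummable_esum sp p0.
have [_ [A [finA _] <-] ltA] := ub_ereal_sup_adherent e0 sfin.
exists A => //.
have spA : rsummable (fun x => if x \in A then 0 else p x).
  by apply: rsummable_le sp _ => x; case: ifP => _; rewrite ?normr0.
have pA0 x : 0 <= (if x \in A then 0 else p x) by case: ifP.
have tfin := rsummable_esum spA pA0.
have E : (\esum_(x in [set: T]) (p x)%:E = \sum_(x \in A) (p x)%:E +
    \esum_(x in [set: T]) (if x \in A then 0 else p x)%:E)%E.
  rewrite (esumID A) ?setTI; last by move=> x _; rewrite lee_fin.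
  rewrite esum_fset //; last by move=> x _; rewrite lee_fin.
  congr (_ + _)%E; rewrite esum_mkcond; apply: eq_esum => x _.
  by rewrite in_setC; case: (x \in A).
have {ltA} : (\esum_(x in [set: T]) (p x)%:E - e%:E <
    \sum_(x \in A) (p x)%:E)%E := ltA.
rewrite E fsbig_finite // sumEFin -(fineK tfin) lteBlDr // -!EFinD lte_fin /=.
by set u := fine _; set w := \sum_(_ <- _) _; lra.
Qed.

(** * Uniqueness of Fourier coefficients *)

Section Fourier.
Variables (R : realType) (n : nat) (S : quadSpace n).
Implicit Types (c : 'rV[rat]_n -> R[i]) (x nu : 'rV[rat]_n).
Local Notation normc := ComplexField.Normc.normc.

(** As the Gram matrix is invertible, x S has a non-zero entry a, and the matching basis vector
    divided by 2a works. The target 1/2 is chosen because the character takes the value -1 there. *)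
Lemma bil_half x : x != 0 -> exists nu, bil S x nu = 2^-1.
Proof.
move=> x0; have : x *m S != 0.
  by apply: contraNneq x0 => xS; rewrite -(mulmxK (gram_nondeg S) x) xS mul0mx.
case/rV0Pn => j aj; have [a Ea] : exists a, a = (x *m S) 0 j by eexists.
rewrite -Ea in aj; exists ((2 * a)^-1 *: delta_mx 0 j).
rewrite /bil linearZ /= -scalemxAr trmx_delta -colE [LHS]mxE [col _ _ _ _]mxE.
by rewrite -Ea invfM -mulrA mulVf // mulr1.
Qed.

Lemma bilBl x y nu : bil S (x - y) nu = bil S x nu - bil S y nu.
Proof. by rewrite /bil !mulmxBl !mxE. Qed.

Lemma bil0r x : bil S x 0 = 0.
Proof. by rewrite /bil trmx0 mulmx0 mxE. Qed.

Definition null_series c :=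
  forall nu, csum [set: 'rV[rat]_n] (fun x => c x * chi R (bil S x nu)) = 0.

Lemma csummable_chi c nu : csummable c ->
  csummable (fun x => c x * chi R (bil S x nu)).
Proof.
move=> sc; apply: csummable_le sc _ => x.
by rewrite ComplexField.Normc.normcM normc_chi mulr1.
Qed.

(* Averaging the series with its translate by nu, where (y - x0, nu) = 1/2,
   keeps the coefficient at x0 and kills the one at y. *)
Lemma null_series_kill c x0 (s : seq 'rV[rat]_n) :
  csummable c -> null_series c ->
  exists c', [/\ csummable c', null_series c', c' x0 = c x0,
    forall x, normc (c' x) <= normc (c x) &
    forall x, x \in s -> x != x0 -> c' x = 0].
Proof.
move=> sc nc; elim: s => [|y s [c' [sc' nc' c'0 c'le c's]]]; first by exists c.
have [->|yx0] := eqVneq y x0.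
  exists c'; split=> // x; rewrite inE => /predU1P[->|]; last exact: c's.
  by rewrite eqxx.
have [nu0 hnu] : exists nu, bil S (y - x0) nu = 2^-1.
  by apply: bil_half; rewrite subr_eq0.
pose c'' x := 2^-1 * (c' x + chi R (bil S (x - x0) nu0) * c' x).
have c''le x : normc (c'' x) <= normc (c' x).
  rewrite /c'' ComplexField.Normc.normcM.
  have -> : normc (2^-1 : R[i]) = 2^-1.
    have -> : (2^-1 : R[i]) = (2^-1 : R)%:C%C by rewrite fmorphV rmorph_nat.
    by rewrite /= expr0n addr0 sqrtr_sqr ger0_norm // invr_ge0.
  have := @le_normcD R (c' x) (chi R (bil S (x - x0) nu0) * c' x).
  rewrite ComplexField.Normc.normcM normc_chi mul1r.
  by set u := normc _; set w := normc _; lra.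
exists c''; split.
- exact: csummable_le sc' c''le.
(* The twisted half of the average is the constant [k] times the old series at nu + nu0, so the new
   series is again null. *)
- move=> nu; pose k := chi R (- bil S x0 nu0).
  rewrite (@eq_csum _ _ _ _ (fun x => 2^-1 * (c' x * chi R (bil S x nu) +
      k * (c' x * chi R (bil S x (nu + nu0)))))); last first.
    have alg (h a u t w : R[i]) :
      h * (a + u * w * a) * t = h * (a * t + w * (a * (t * u))) by ring.
    by move=> x _; rewrite /c'' /k bilBl bilDr !chiD alg.
  have s1 := csummable_chi nu sc'; have s2 := csummable_chi (nu + nu0) sc'.
  have s3 := csummableZ k s2.
  rewrite (csumZ _ (csummableD s1 s3)) (csumD s1 s3) (csumZ _ s2) !nc'.
  by rewrite mulr0 addr0 mulr0.
- rewrite /c'' subrr c'0 (_ : bil S 0 nu0 = 0); last by rewrite /bil !mul0mx mxE.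
  rewrite chi0 mul1r; apply: (@mulfI _ 2); rewrite ?pnatr_eq0 //.
  by rewrite mulrA mulfV ?pnatr_eq0 // mul1r mulrDl mul1r.
- by move=> x; apply: le_trans (c'le x).
- move=> x; rewrite inE => /predU1P[->|xs] xx0.
    by rewrite /c'' hnu chi_half mulN1r subrr mulr0.
  by rewrite /c'' c's // !mulr0 addr0 mulr0.
Qed.

(** Let a finite set A carry all but e of the total modulus. After killing the coefficients on A
    other than the one at x0, the null series at nu = 0 expresses c(x0) through terms outside A,
    whose total modulus is at most e. *)
Lemma fourier_unique c : csummable c -> null_series c -> forall x, c x = 0.
Proof.
move=> sc nc x0.
suff h e : 0 < e -> `|complex.Re (c x0)| <= e /\ `|complex.Im (c x0)| <= e.
  apply/eqP; rewrite eq_complex -!normr_le0; apply/andP; split;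
    by apply/ler_addgt0Pr => e /h[]; rewrite add0r.
move=> e0; have [A finA tailA] := rsummable_tail sc (fun x => normc_ge0 (c x)) e0.
have /finite_seqP[s sA] := finA.
have [c' [sc' nc' c'0 c'le c's]] := null_series_kill x0 s sc nc.
pose d1 x := if x == x0 then c' x else 0.
pose d2 x := if x == x0 then 0 else - c' x.
have s1 : csummable d1.
  apply: csummable_le sc' _ => x; rewrite /d1; case: ifP => // _.
  by rewrite [leLHS]/= expr0n addr0 sqrtr0 normc_ge0.
have n2 x : normc (d2 x) <= if x \in A then 0 else normc (c x).
  rewrite /d2; case: ifPn => [_|xx0].
    by rewrite [leLHS]/= expr0n addr0 sqrtr0; case: ifP; rewrite ?normc_ge0.
  rewrite (@normcN R); case: ifPn => // xA.
  move: xA; rewrite sA inE /= => xs.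
  by rewrite c's //= expr0n addr0 sqrtr0.
have rA : rsummable (fun x => if x \in A then 0 else normc (c x)).
  by apply: rsummable_le sc _ => x; case: ifP => _; rewrite ?normr0.
have s2 : csummable d2.
  apply: rsummable_le rA _ => x; rewrite !ger0_norm ?normc_ge0 //.
  by case: ifP => _; rewrite ?normc_ge0.
have -> : c x0 = csum [set: 'rV[rat]_n] d2.
  have := nc' 0; rewrite (@eq_csum _ _ _ _ (fun x => d1 x + (-1) * d2 x)); last first.
    move=> x _; rewrite bil0r chi0 mulr1 /d1 /d2; case: ifP => _.
      by rewrite mulr0 addr0.
    by rewrite add0r mulN1r opprK.
  rewrite (csumD s1 (csummableZ _ s2)) (csumZ _ s2).
  rewrite (@csum_single _ _ x0 d1); last by move=> x; rewrite /d1 => /negbTE ->.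
  by rewrite /d1 eqxx c'0 mulN1r => /eqP; rewrite subr_eq0 => /eqP.
have [h1 h2] := csum_Re_Im_le rA n2.
by split; [apply: le_trans h1 _ | apply: le_trans h2 _].
Qed.

End Fourier.

(** * Lifting along a horizontal isotropic subgroup *)

Section CharacterSums.
Variable R : realType.

(** Translation by x0 permutes K and multiplies the sum by the value of the character at x0, which
    is not 1. *)
Lemma char_sum0 (E : zmodType) (K : set E) (f : E -> QmodZ) x0 :
  (forall x, K x -> K (x + x0)) -> (forall x, K x -> K (x - x0)) ->
  (forall x, f (x + x0) = f x + f x0) -> f x0 != 0 ->
  \sum_(x \in K) chiQ R (f x) = 0.
Proof.
move=> KD KB fD f0.
have bK : set_bij K K (fun x => x + x0).
  split=> [x /KD //|x y _ _ /addIr //|x Kx].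
  by exists (x - x0); [exact: KB | rewrite subrK].
have u1 : chiQ R (f x0) != 1 by apply: contra_neq f0 => /chiQ_eq1.
set X := LHS; have : X = X * chiQ R (f x0).
  rewrite {1}/X (reindex_fsbig (fun x => x + x0) K K) // mulr_fsuml.
  by apply: eq_fsbigr => x _; rewrite fD chiQD.
move/eqP; rewrite -subr_eq0 -{1}[X]mulr1 -mulrBr mulf_eq0 subr_eq0.
by rewrite [1 == _]eq_sym (negbTE u1) orbF => /eqP.
Qed.

Lemma dsum_bformE (A B : quadMod) (x y : dsum A B) :
  bform x y = bform x.1 y.1 + bform x.2 y.2.
Proof. exact: qsum_polarE. Qed.

(* Summing the characters e((a,h_L) + (d,h_D)) over a and h in H: if no (a,d) were
   orthogonal to H, every inner sum over H would vanish, whereas summing over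
   a first leaves only the term h = 0. *)
Lemma perp_lift (A B : quadMod) (H : isotropic (dsum A B)) (d : B) :
  discriminant_form A -> finite_set [set: B] ->
  (forall b : B, ((0, b) : dsum A B) \in iso_sub H -> b = 0) ->
  exists a : A, ((a, d) : dsum A B) \in perp H.
Proof.
move=> [finA ndA] finB horH; apply: contrapT => /forallNP noa.
pose HH : set (dsum A B) := [set h | h \in iso_sub H].
have finHH : finite_set HH.
  apply: (@sub_finite_set _ _ ([set: A] `*` [set: B])) => //.
  exact: finite_setX.
pose X : R[i] := \sum_(a \in [set: A]) \sum_(h \in HH)
  chiQ R (bform ((a, d) : dsum A B) h).
have X0 : X = 0.
  rewrite /X fsbig1 // => a _.
  have /existsNP[h0 /not_implyP[h0H /eqP h0a]] :
      ~ (forall y, y \in iso_sub H -> bform ((a, d) : dsum A B) y = 0).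
    by move=> h; apply: (noa a); apply/perpP.
  apply: (@char_sum0 _ HH _ h0) => [x xH|x xH|x|//].
  - exact: (@rpredD _ (iso_sub H)).
  - exact: (@rpredB _ (iso_sub H)).
  - by rewrite bformC bformDl [in RHS]bformC; congr (_ + _); rewrite bformC.
have inner0 (h : dsum A B) : HH h -> h <> 0 ->
    \sum_(a \in [set: A]) chiQ R (bform ((a, d) : dsum A B) h) = 0.
  move=> hH h0.
  (* Horizontality: an element of H with zero first component is zero, so a non-zero h gives a
     non-trivial character of A. *)
  have h10 : h.1 <> 0.
    move=> h1; apply: h0; move: hH; rewrite /HH /=.
    by case: h h1 => h1 h2 /= -> /horH ->.
  have /existsNP[a0 /eqP a0h] : ~ (forall y : A, bform h.1 y = 0).
    by move=> /ndA.
  rewrite (@eq_fsbigr _ _ _ _ _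
      (fun a => chiQ R (bform a h.1) * chiQ R (bform d h.2))); last first.
    by move=> a _; rewrite dsum_bformE chiQD.
  rewrite -mulr_fsuml (@char_sum0 _ _ _ a0) ?mul0r // => [x|].
    by rewrite bformDl.
  by rewrite bformC.
have : X = (\sum_(a \in [set: A]) (1 : R[i]))%R.
  pose Y (h : dsum A B) : R[i] :=
    \sum_(a \in [set: A]) chiQ R (bform ((a, d) : dsum A B) h).
  have -> : X = \sum_(h \in HH) Y h by exact: exchange_fsbig.
  have -> : \sum_(h \in HH) Y h = \sum_(h \in [set 0]) Y h.
    apply/esym/fsbig_widen => [h ->|h [hH h0]]; last exact: inner0.
    exact: (@rpred0 _ (iso_sub H)).
  rewrite fsbig_set1 /Y; apply: eq_fsbigr => a _.
  by rewrite bformC bform0l chiQ0.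
(* Now 0 equals the number of elements of A, which is absurd since A contains 0. *)
rewrite X0 fsbig_finite //= big_tnth sumr_const card_ord => /esym/eqP.
rewrite pnatr_eq0 => /eqP/size0nil/= h0.
have := in_fset_set finA (0 : A); rewrite [RHS]mem_set // => in0.
have : (0 : A) \in finmap.enum_fset (fset_set [set: A]) by exact: in0.
by rewrite h0.
Qed.
End CharacterSums.

(** * Convergence and transformation of theta series *)

Lemma geometric_sum_le (R : realType) (r : R) (K : nat) : 0 <= r < 1 ->
  \sum_(j < K) r ^+ j <= (1 - r)^-1.
Proof.
move=> /andP[r0 r1]; have r1' : 0 < 1 - r by rewrite subr_gt0.
rewrite -(ler_pM2l r1') mulfV ?gt_eqF // -opprB mulNr -subrX1 opprB.
by rewrite lerBlDr lerDl exprn_ge0.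
Qed.

(** The vectors k(x) are distinct points of Z^n, and the sum of r^(|k_1| + ... + |k_n|) over Z^n is
    a product of n two-sided geometric series, each at most 2 / (1 - r). *)
Lemma rsummable_geometric (R : realType) (T : choiceType) (n : nat)
    (X : set T) (k : T -> 'I_n -> int) (f : T -> R) (C r : R) :
  0 <= C -> 0 <= r < 1 ->
  (forall x y, X x -> X y -> (forall i, k x i = k y i) -> x = y) ->
  (forall x, 0 <= f x) -> (forall x, ~ X x -> f x = 0) ->
  (forall x, X x -> f x <= C * \prod_i r ^+ `|k x i|%N) ->
  rsummable f.
Proof.
move=> C0 r01 kinj f0 fX fle.
have r0 : 0 <= r by case/andP: r01.
apply: (@le_lt_trans _ _ (C * (2 * (1 - r)^-1) ^+ n)%:E); last exact: ltry.
apply: ge_ereal_sup => _ [A [finA _] <-].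
have [s us As] : exists2 s : seq T, uniq s & A = [set` s].
  by have /finite_seqP[s ->] := finA; exists (undup s); rewrite ?undup_uniq //;
     apply/seteqP; split=> x /=; rewrite mem_undup.
rewrite As -fsbig_seq //= sumEFin lee_fin.
pose u := [seq x <- s | `[< X x >]].
have -> : \sum_(x <- s) `|f x| = \sum_(x <- u) f x.
  rewrite big_filter [RHS]big_mkcond /=; apply: eq_bigr => x _.
  by rewrite ger0_norm //; case: asboolP => // /fX.
have uX x : x \in u -> X x by rewrite mem_filter => /andP[/asboolP].
pose K := \max_(x <- u) \max_(i < n) `|k x i|%N.
have kK x i : x \in u -> (`|k x i| <= K)%N.
  move=> xu; apply: leq_trans (leq_bigmax_seq _ xu isT).
  exact: (@leq_bigmax _ (fun i => `|k x i|%N)).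
(* A finite partial sum sees only |k_i| <= K. Recording sign and absolute value makes the index set
   a finite function space, over which the sum of products factors. The pair of negative sign and
   value 0 is never hit and only enlarges the bound. *)
pose enc x : {ffun 'I_n -> bool * 'I_K.+1} :=
  [ffun i => (k x i < 0, inord `|k x i|%N)].
pose G (phi : {ffun 'I_n -> bool * 'I_K.+1}) : R := \prod_i r ^+ (phi i).2.
have G0 phi : 0 <= G phi by apply: prodr_ge0 => i _; rewrite exprn_ge0.
have encG x : x \in u -> \prod_i r ^+ `|k x i|%N = G (enc x).
  by move=> xu; apply: eq_bigr => i _; rewrite ffunE /= inordK // ltnS kK.
have encinj : {in u &, injective enc}.
  move=> x y xu yu exy; apply: kinj; [exact: uX|exact: uX|] => i.
  move/ffunP/(_ i): exy; rewrite !ffunE => -[es /(congr1 val)].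
  rewrite /= !inordK ?ltnS ?kK // => ea.
  rewrite [k x i]intEsign [k y i]intEsign.
  by rewrite ea es.
have uu : uniq (map enc u) by rewrite map_inj_in_uniq // filter_uniq.
apply: (@le_trans _ _ (C * \sum_(phi <- map enc u) G phi)).
  rewrite mulr_sumr big_map big_seq [leRHS]big_seq; apply: ler_sum => x xu.
  by rewrite -encG //; exact/fle/uX.
rewrite ler_wpM2l // big_uniq //=.
apply: (@le_trans _ _ (\sum_phi G phi)).
  by rewrite [leRHS](bigID (mem (map enc u))) /= lerDl sumr_ge0.
rewrite /G -(bigA_distr_bigA (fun (i : 'I_n) (j : bool * 'I_K.+1) => r ^+ j.2)) /=.
rewrite prodr_const card_ord lerXn2r ?nnegrE ?sumr_ge0 //.
- by move=> i _; rewrite exprn_ge0.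
- by rewrite mulr_ge0 // invr_ge0; case/andP: r01; lra.
rewrite -(pair_bigA _ (fun (b : bool) (j : 'I_K.+1) => r ^+ j)) /= big_bool /=.
by have := geometric_sum_le K.+1 r01; lra.
Qed.

Section ThetaTerm.
Variables (R : realType) (n : nat) (S : quadSpace n) (v : splitting R S).
Local Notation normc := ComplexField.Normc.normc.
Local Notation B := (bil (gramR R S)).
Local Notation P := (projp v).
Local Notation M := (projm v).
Implicit Types (x s nu : 'rV[rat]_n) (w u : 'rV[R]_n) (zeta : 'rV[R[i]]_n).

Lemma projpD w u : P (w + u) = P w + P u.
Proof. exact: raddfD. Qed.

Lemma projmD w u : M (w + u) = M w + M u.
Proof. exact: raddfD. Qed.

Lemma proj_sum w : P w + M w = w.
Proof. by apply: daddv_pi_add; rewrite ?split_cap // split_sum memvf. Qed.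

Lemma projp_mem w : P w \in vpos v. Proof. exact: memv_pi. Qed.
Lemma projm_mem w : M w \in vneg v. Proof. exact: memv_pi. Qed.

Lemma gramR_sym : (gramR R S)^T = gramR R S.
Proof. by rewrite /gramR map_trmx gram_sym. Qed.

Lemma bilpm w u : B (P w) (M u) = 0.
Proof. exact: split_orth (projp_mem w) (projm_mem u). Qed.

Lemma bilmp w u : B (M w) (P u) = 0.
Proof. by rewrite (bilC _ _ gramR_sym) bilpm. Qed.

Lemma bil_proj w u : B w u = B (P w) (P u) + B (M w) (M u).
Proof.
by rewrite -{1}(proj_sum w) -{1}(proj_sum u) bilDl !bilDr bilpm bilmp addr0 add0r.
Qed.

(** The Siegel majorant of the quadratic form attached to v: the definite form obtained by changing
    the sign on v_-. *)
Definition majorant w := B (P w) (P w) - B (M w) (M w).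

Lemma majorant_ge0 w : 0 <= majorant w.
Proof.
rewrite subr_ge0; apply: (@le_trans _ _ 0).
  have [->|m0] := eqVneq (M w) 0; first by rewrite /bil !mul0mx mxE.
  exact/ltW/(split_neg (projm_mem w)).
have [->|p0] := eqVneq (P w) 0; first by rewrite /bil !mul0mx mxE.
exact/ltW/(split_pos (projp_mem w)).
Qed.

Lemma bilZl (a : R) w u : B (a *: w) u = a * B w u.
Proof. by rewrite /bil -!scalemxAl mxE. Qed.

Lemma bilZr (a : R) w u : B w (a *: u) = a * B w u.
Proof. by rewrite /bil linearZ -scalemxAr mxE. Qed.

(* Positivity of the majorant at w + a (u_+ - u_-): Cauchy-Schwarz before
   optimising over a. *)
Lemma majorant_cauchy (a : R) w u :
  0 <= majorant w + 2 * a * B w u + a ^+ 2 * majorant u.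
Proof.
pose u' := P u - M u.
have Pu' : P u' = P u.
  have -> : P u' = P (P u) - P (M u) by exact: raddfB.
  have PP := daddv_pi_proj u (split_cap v).
  have : P u = P (P u) + P (M u) by rewrite -projpD proj_sum.
  rewrite -[P (P u)]/(daddv_pi _ _ (daddv_pi _ _ u)) PP => /eqP.
  by rewrite addrC -subr_eq subrr eq_sym => /eqP ->; rewrite subr0.
have Mu' : M u' = - M u.
  have := proj_sum u'; rewrite Pu' /u' => /addrI; exact.
have := majorant_ge0 (w + a *: u'); rewrite /majorant projpD projmD.
have -> : P (a *: u') = a *: P u' by exact: linearZ.
have -> : M (a *: u') = a *: M u' by exact: linearZ.
rewrite Pu' Mu' scalerN -scaleNr !bilDl !bilDr !bilZl !bilZr (bil_proj w u).
rewrite (bilC (P u) (P w) gramR_sym) (bilC (M u) (M w) gramR_sym).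
by lra.
Qed.

(** [majorant_cauchy] at a = -(w, u) / (majorant u + 1). The added 1 keeps the denominator positive
    when u = 0 and costs only a weaker constant. *)
Lemma majorant_ge_sqr w u : (B w u) ^+ 2 <= majorant w * (majorant u + 1).
Proof.
have q0 := majorant_ge0 u; set q := majorant u in q0 *.
have := majorant_cauchy (- B w u / (q + 1)) w u; rewrite -/q.
set b := B w u; set m := majorant w.
have q1 : 0 < q + 1 by lra.
have [t tq] : exists t, t * (q + 1) = 1 by exists (q + 1)^-1; rewrite mulVf ?gt_eqF.
have t0 : 0 < t by rewrite -(pmulr_lgt0 _ q1) tq.
have -> : - b / (q + 1) = - b * t.
  by congr (_ * _); apply: (mulIf (lt0r_neq0 q1)); rewrite tq mulVf ?gt_eqF.
move=> h; have tb : 0 <= t * b ^+ 2 by rewrite mulr_ge0 ?sqr_ge0 ?ltW.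
have {}h : 0 <= m - t * b ^+ 2 - t * (t * b ^+ 2).
  suff <- : m + 2 * (- b * t) * b + (- b * t) ^+ 2 * q =
      m - t * b ^+ 2 - t * (t * b ^+ 2) by [].
  have -> : (- b * t) ^+ 2 * q = t * b ^+ 2 * (t * (q + 1) - t) by ring.
  by rewrite tq; ring.
have {}h : 0 <= (m - t * b ^+ 2 - t * (t * b ^+ 2)) * (q + 1) := mulr_ge0 h (ltW q1).
move: h; have -> : (m - t * b ^+ 2 - t * (t * b ^+ 2)) * (q + 1) =
    m * (q + 1) - (t * (q + 1)) * (b ^+ 2 + t * b ^+ 2) by ring.
by rewrite tq mul1r; lra.
Qed.

Lemma gramCE : gramC R S = map_mx (real_complex R) (gramR R S).
Proof. by apply/matrixP => i j; rewrite !mxE ratr_complex. Qed.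

Lemma toCE x : toC R x = map_mx (real_complex R) (toR R x).
Proof. by apply/matrixP => i j; rewrite !mxE ratr_complex. Qed.

Lemma bilC_real w u :
  bil (gramC R S) (map_mx (real_complex R) w) (map_mx (real_complex R) u) =
  (B w u)%:C%C.
Proof. by rewrite /bil gramCE map_trmx -!map_mxM mxE. Qed.

Lemma bil_toR x nu : B (toR R x) (toR R nu) = ratr (bil S x nu).
Proof. by rewrite /bil /gramR /toR map_trmx -!map_mxM mxE. Qed.

Lemma bil_toC x nu : bil (gramC R S) (toC R x) (toC R nu) = ratr (bil S x nu).
Proof. by rewrite !toCE bilC_real bil_toR ratr_complex. Qed.

Lemma bilCZr (a : R[i]) (z zeta : 'rV[R[i]]_n) :
  bil (gramC R S) z (a *: zeta) = a * bil (gramC R S) z zeta.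
Proof. by rewrite /bil linearZ -scalemxAr mxE. Qed.

Lemma Im_bil x zeta : complex.Im (bil (gramC R S) (toC R x) zeta) =
  B (toR R x) (map_mx (@complex.Im R) zeta).
Proof.
have {1}-> : zeta = map_mx (real_complex R) (map_mx (@complex.Re R) zeta) +
    'i%C *: map_mx (real_complex R) (map_mx (@complex.Im R) zeta).
  by apply/rowP => i; rewrite !mxE; exact: complexE.
rewrite bilDr bilCZr toCE !bilC_real /=.
by rewrite !mul0r mul1r !add0r.
Qed.

Definition theta_term (tau : upper_half R) zeta x : R[i] :=
  ee (gauss v tau x + bil (gramC R S) (toC R x) zeta).

Lemma theta_term_neq0 tau zeta x : theta_term tau zeta x != 0.
Proof. exact: ee_neq0. Qed.

Lemma toRD x s : toR R (x + s) = toR R x + toR R s.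
Proof. exact: map_mxD. Qed.

Lemma gaussD tau x s : gauss v tau (x + s) = gauss v tau x + gauss v tau s +
  (val tau * (B (P (toR R x)) (P (toR R s)))%:C%C +
   (val tau)^*%C * (B (M (toR R x)) (M (toR R s)))%:C%C).
Proof.
rewrite /gauss toRD projpD projmD !bilDl !bilDr.
rewrite (bilC (P (toR R s)) (P (toR R x)) gramR_sym).
rewrite (bilC (M (toR R s)) (M (toR R x)) gramR_sym).
set t := val tau; set t' := (t^*)%C.
have alg (a b c : R) :
    ((a + b + (b + c)) / 2)%:C%C = (a / 2)%:C%C + (c / 2)%:C%C + b%:C%C.
  by rewrite -!rmorphD; congr (_%:C)%C; lra.
rewrite !alg !mulrDr.
move: (t * _) (t * _) (t * _) (t' * _) (t' * _) (t' * _) => a1 a2 a3 b1 b2 b3.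
ring.
Qed.

(** Completing the square: as v_+ and v_- are orthogonal, pairing x with tau s_+ + conj(tau) s_-
    gives exactly the cross terms of [gauss] at x + s. The rational shift nu contributes only a
    character of x. *)
Lemma theta_term_shift tau zeta s nu x :
  theta_term tau (elliptic_shift v tau zeta s nu) x =
  ee (- gauss v tau s - bil (gramC R S) (toC R s) zeta) *
    (theta_term tau zeta (x + s) * chi R (bil S x nu)).
Proof.
rewrite /theta_term /chi -!eeD; congr ee.
rewrite /elliptic_shift !bilDr !bilCZr bil_toC gaussD.
have -> : toC R (x + s) = toC R x + toC R s by exact: map_mxD.
rewrite bilDl [in LHS]toCE !bilC_real -toCE.
have -> : B (toR R x) (P (toR R s)) = B (P (toR R x)) (P (toR R s)).
  by rewrite -{1}(proj_sum (toR R x)) bilDl bilmp addr0.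
have -> : B (toR R x) (M (toR R s)) = B (M (toR R x)) (M (toR R s)).
  by rewrite -{1}(proj_sum (toR R x)) bilDl bilpm add0r.
have alg (a b c d e f g : R[i]) :
  c + (e + a + b + g) = - d - f + (c + d + (a + b) + (e + f) + g) by ring.
exact: alg.
Qed.

(** tau and its conjugate have opposite imaginary parts, which is what turns the indefinite form
    into the majorant. *)
Lemma normc_theta_term tau zeta x : normc (theta_term tau zeta x) =
  expR (- (2 * pi * (complex.Im (val tau) / 2 * majorant (toR R x) +
    B (toR R x) (map_mx (@complex.Im R) zeta)))).
Proof.
rewrite normc_ee; congr (expR (- (_ * _))).
rewrite -Im_bil /gauss /majorant; move: (bil (gramC R S) _ _) => [a b].
case: (val tau) => t y /=; lra.
Qed.

(** Let k_i be the integers (x, b_i) for a basis b_i of N, and Q the majorant of x. Of the exponent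
    y Q / 2, one half absorbs the term linear in x up to a constant, and the other half dominates a
    multiple of the sum of the |k_i|, because |k_i| <= k_i^2 <= Q (q_i + 1). A geometric majorant
    results. *)
Lemma csummable_theta_term (N : evenLattice S) tau zeta :
  csummable (fun x => if x \in dual_lattice N then theta_term tau zeta x else 0).
Proof.
have [Bm Bu NB] := lat_basis N.
have dualE := dual_lattice_coord NB.
set T := S *m Bm^T in dualE.
have Tu : T \in unitmx by rewrite unitmx_mul gram_nondeg unitmx_tr.
have TE x i : (x *m T) 0 i = bil S x (row i Bm).
  by rewrite mulmxA /bil mxE [RHS]mxE; apply: eq_bigr => k _; rewrite !mxE.
have y0 : 0 < complex.Im (val tau) := valP tau.
set y := complex.Im (val tau) in y0.
pose eta : 'rV[R]_n := map_mx (@complex.Im R) zeta.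
pose q i := majorant (toR R (row i Bm)).
have q0 i : 0 <= q i by exact: majorant_ge0.
(* The leading 1 keeps [Mx] positive when n = 0. *)
pose Mx := 1 + \sum_i (q i + 1).
have Mx0 : 0 < Mx by rewrite ltr_pwDl // sumr_ge0 // => i _; rewrite addr_ge0.
(* The price of absorbing (x, eta) into y Q / 4, from [majorant_cauchy] at a = 2 / y; [kap] below is
   chosen so that kap Mx = y / 4. *)
pose K := majorant eta / y.
pose kap := y / (4 * Mx).
have kap0 : 0 < kap by rewrite divr_gt0 // mulr_gt0.
(* The floor merely reads off an integer: these pairings are integral on the dual lattice. *)
pose k x i := Num.floor (bil S x (row i Bm)).
apply: (@rsummable_geometric _ _ n [set x | x \in dual_lattice N] k _
  (expR (2 * pi * K)) (expR (- (2 * pi * kap)))).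
- exact: expR_ge0.
- rewrite expR_ge0 expR_lt1 oppr_lt0 mulr_gt0 // mulr_gt0 ?pi_gt0 //.
- move=> x x' /dualE[z Ez] /dualE[z' Ez'] kk; apply: (can_inj (mulmxK Tu)).
  apply/rowP => i; have := kk i; rewrite /k -!TE Ez Ez' !mxE !intrKfloor.
  by move=> ->.
- by move=> x; exact: normc_ge0.
- by move=> x /= /negP/negbTE ->; rewrite /= expr0n addr0 sqrtr0.
move=> x /= xN; rewrite xN normc_theta_term -/y -/eta.
have kE i : bil S x (row i Bm) = (k x i)%:~R.
  have [z Ez] := (dualE x).1 xN.
  by rewrite /k -!TE Ez mxE intrKfloor.
set Q := majorant (toR R x).
have Q0 : 0 <= Q := majorant_ge0 _.
have sumk : \sum_i (`|k x i|%N)%:R <= Q * Mx.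
  apply: (@le_trans _ _ (\sum_i Q * (q i + 1))).
    apply: ler_sum => i _.
    have := majorant_ge_sqr (toR R x) (toR R (row i Bm)).
    rewrite bil_toR kE ratr_int -/Q -/(q i); apply: le_trans.
    rewrite -real_normK ?num_real // -intr_norm -abszE.
    rewrite -pmulrn -natrX ler_nat.
    by case: absz => // m; rewrite -{1}[m.+1]expn1 leq_pexp2l.
  by rewrite -mulr_sumr ler_wpM2l // /Mx lerDr.
have bnd : kap * \sum_i (`|k x i|%N)%:R - K <= y / 2 * Q + B (toR R x) eta.
  have h1 : kap * \sum_i (`|k x i|%N)%:R <= y / 4 * Q.
    apply: (@le_trans _ _ (kap * (Q * Mx))); first by rewrite ler_pM2l.
    have -> : kap * (Q * Mx) = y / 4 * Q * (Mx / Mx) by rewrite /kap invfM; ring.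
    by rewrite divff ?gt_eqF // mulr1.
  have h2 : 0 <= y / 4 * Q + B (toR R x) eta + K.
    have := majorant_cauchy (2 / y) (toR R x) eta; rewrite -/Q.
    rewrite -(pmulr_rge0 _ (_ : 0 < y / 4)); last lra.
    suff -> : y / 4 * (Q + 2 * (2 / y) * B (toR R x) eta + (2 / y) ^+ 2 * majorant eta)
      = y / 4 * Q + B (toR R x) eta + K by [].
    rewrite /K; field; exact: lt0r_neq0.
  by move: h1 h2; lra.
apply: (@le_trans _ _ (expR (2 * pi * K + \sum_i - (2 * pi * kap) * (`|k x i|%N)%:R))).
  rewrite ler_expR -mulr_sumr.
  have := ler_wpM2l (_ : 0 <= 2 * pi) bnd.
  rewrite mulr_ge0 ?pi_ge0 // => /(_ isT); rewrite mulrBr; lra.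
rewrite expRD ler_wpM2l ?expR_ge0 // expR_sum; apply: ler_prod => i _.
by rewrite expR_ge0 mulrC expRM_natl lexx.
Qed.

End ThetaTerm.

(** * Reduction modulo isotropic subgroups *)

Lemma coset_perpD (E : quadMod) (Y : isotropic E) (x y : E) :
  x \in perp Y -> y \in perp Y ->
  coset_perp Y (x + y) = coset_perp Y x + coset_perp Y y.
Proof.
move=> xY yY; rewrite -[y in LHS]opprK coset_perpB ?rpredN // -[- y]sub0r.
by rewrite coset_perpB ?rpred0 // coset_perp0 sub0r opprK.
Qed.

Lemma coset_perp_bform (E : quadMod) (Y : isotropic E) (x y : E) :
  x \in perp Y -> y \in perp Y ->
  bform (coset_perp Y x) (coset_perp Y y) = bform x y.
Proof.
by move=> xY yY; rewrite /bform /polar -coset_perpD // !coset_perp_qE // rpredD.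
Qed.

Lemma coset_perp_surj (E : quadMod) (Y : isotropic E) (c : perp_quot Y) :
  exists2 x, x \in perp Y & coset_perp Y x = c.
Proof.
exists (val (repr c : perp_sub Y)); first exact: valP.
by rewrite /coset_perp valKd reprK.
Qed.

Lemma perp_quot_finite (E : quadMod) (Y : isotropic E) :
  finite_set [set: E] -> finite_set [set: perp_quot Y].
Proof.
move=> finE; apply: (@sub_finite_set _ _ (coset_perp Y @` [set: E])).
  by move=> c _; have [x _ <-] := coset_perp_surj c; exists x.
exact: finite_image.
Qed.

Lemma dsum_finite (A B : quadMod) : finite_set [set: A] -> finite_set [set: B] ->
  finite_set [set: dsum A B].
Proof.
move=> finA finB; apply: (@sub_finite_set _ _ ([set: A] `*` [set: B])) => //.
exact: finite_setX.
Qed.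

Lemma iso_sub_perp (E : quadMod) (Y : isotropic E) (x : E) :
  x \in iso_sub Y -> x \in perp Y.
Proof.
move=> xY; apply/perpP => y yY; rewrite /bform /polar !(iso_qform0 (i := Y)) ?subrr //.
exact: (@rpredD _ (iso_sub Y)).
Qed.

Lemma disc_bform (n : nat) (S : quadSpace n) (N : evenLattice S) x y :
  x \in dual_lattice N -> y \in dual_lattice N ->
  bform (disc_coset N x) (disc_coset N y) = toQmodZ (bil S x y).
Proof.
by move=> xN yN; rewrite coset_perp_bform // /bform ratquad_polarE.
Qed.

Section GroupAlgebraTheory.
Variable R : realType.

Lemma esetsumE (E : quadMod) (A : set E) x : esetsum R A x = (x \in A)%:R.
Proof.
rewrite /esetsum /ebasis; case: (boolP (x \in A)) => xA.
  rewrite -(@fsbig_widen _ _ _ _ [set x] A).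
  - by rewrite fsbig_set1 eqxx.
  - by move=> y ->; rewrite inE in xA.
  - by move=> y [_ /= /eqP yx]; rewrite eq_sym (negbTE yx).
rewrite fsbig1 // => y Ay; case: eqVneq => // xy.
by move: xA; rewrite xy notin_setE.
Qed.

Lemma linext_single (E E' : quadMod) (u : E -> galg R E') (f : galg R E) y g0 :
  (forall g, g <> g0 -> u g y = 0) -> linext u f y = f g0 * u g0 y.
Proof.
move=> u0; rewrite /linext -(@fsbig_widen _ _ _ _ [set g0] [set: E]) ?fsbig_set1 //.
by move=> g [_ /= gg0]; rewrite u0 // mulr0.
Qed.

Lemma linext0 (E E' : quadMod) (u : E -> galg R E') (f : galg R E) y :
  (forall g, u g y = 0) -> linext u f y = 0.
Proof. by move=> u0; rewrite /linext fsbig1 // => g _; rewrite u0 mulr0. Qed.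

Lemma upE (E : quadMod) (Y : isotropic E) (f : galg R (perp_quot Y)) d :
  up Y f d = if d \in perp Y then f (coset_perp Y d) else 0.
Proof.
rewrite /up; case: ifPn => dY.
  rewrite (@linext_single _ _ _ _ _ (coset_perp Y d)).
    by rewrite esetsumE mem_set ?mulr1.
  by move=> g gd; rewrite esetsumE memNset // => -[_ /esym].
rewrite linext0 // => g; rewrite esetsumE memNset // => -[dY' _].
by rewrite dY' in dY.
Qed.

Lemma calPE (n : nat) (S : quadSpace n) (L M : evenLattice S)
    (D : quadMod) (H : isotropic (dsum (disc L) D))
    (f : galg R (perp_quot (Hbar M H))) b a :
  (forall a', p_rel b a' -> a' = a) -> p_rel b a -> calP M H f b = f a.
Proof.
move=> ua ba; rewrite /calP (@linext_single _ _ _ _ _ a).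
  by rewrite esetsumE mem_set ?mulr1.
by move=> g ga; rewrite esetsumE memNset // => /ua.
Qed.

Lemma calP0 (n : nat) (S : quadSpace n) (L M : evenLattice S)
    (D : quadMod) (H : isotropic (dsum (disc L) D))
    (f : galg R (perp_quot (Hbar M H))) b :
  (forall a : perp_quot (Hbar M H), ~ p_rel b a) -> calP M H f b = 0.
Proof.
by move=> na; rewrite /calP linext0 // => g; rewrite esetsumE memNset // => /na.
Qed.

End GroupAlgebraTheory.

(** * Components of Phi as Fourier series in zeta *)

Section PhiSeries.
Variables (R : realType) (n : nat) (S : quadSpace n) (v : splitting R S).
Variables (N : evenLattice S) (D : quadMod) (H : isotropic (dsum (disc N) D)).
Hypothesis finD : finite_set [set: D].
Implicit Types (F : galg R D) (b : perp_quot H) (x : 'rV[rat]_n).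

(* The coefficient of e(gauss x + (x, zeta)) in the b-component of Phi. *)
Definition Phi_coef F b x : R[i] :=
  \sum_(g \in [set: dsum (disc N) D])
    (if [&& x \in dual_lattice N, disc_coset N x == g.1, g \in perp H &
            coset_perp H g == b] then F g.2 else 0).

Let finE : finite_set [set: dsum (disc N) D].
Proof. by apply: dsum_finite => //; have [] := disc_discriminant_form N. Qed.

(** With the finite sum over g outermost, the series becomes a linear combination of theta series of
    single cosets, so convergence and termwise summation reduce to those. *)
Lemma Phi_coef_term F b tau zeta :
  (fun x => Phi_coef F b x * theta_term v tau zeta x) =
  (fun x => \sum_(g <- finmap.enum_fset (fset_set [set: dsum (disc N) D]))
    ((if (g \in perp H) && (coset_perp H g == b) then F g.2 else 0) *
     (if (x \in dual_lattice N) && (disc_coset N x == g.1)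
      then theta_term v tau zeta x else 0))).
Proof.
apply/funext => x; rewrite /Phi_coef fsbig_finite // mulr_suml.
apply: eq_bigr => g _; rewrite andbA.
by case: ((x \in _) && _); case: ((g \in _) && _); rewrite /= ?mul0r ?mulr0.
Qed.

Lemma csummable_theta_coset tau zeta (a : disc N) :
  csummable (fun x => if (x \in dual_lattice N) && (disc_coset N x == a)
      then theta_term v tau zeta x else 0).
Proof.
apply: csummable_le (csummable_theta_term v N tau zeta) _ => x.
case: (x \in _); rewrite ?andTb //; case: ifP => // _.
by rewrite [leLHS]/= expr0n addr0 sqrtr0 normc_ge0.
Qed.

Lemma csummable_Phi_coef F b tau zeta :
  csummable (fun x => Phi_coef F b x * theta_term v tau zeta x).
Proof.
rewrite Phi_coef_term; apply: csummable_sum => g.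
exact/csummableZ/csummable_theta_coset.
Qed.

Lemma Phi_series (F : upper_half R -> galg R D) b tau zeta :
  Phi v H F tau zeta b =
  csum [set: 'rV[rat]_n] (fun x => Phi_coef (F tau) b x * theta_term v tau zeta x).
Proof.
rewrite Phi_coef_term csum_sum; last first.
  by move=> g; exact/csummableZ/csummable_theta_coset.
rewrite /Phi /Defs.down /linext fsbig_finite //; apply: eq_bigr => g _.
rewrite csumZ; last exact: csummable_theta_coset.
rewrite /tensor /theta csum_mkcond.
set c1 := csum _ _; set c2 := csum _ _.
have -> : c1 = c2.
  apply: eq_csum => x _; congr (if _ then _ else _).
  apply/idP/idP => [|/andP[xN /eqP xg]]; last by rewrite inE.
  by rewrite inE /= => -[-> ->]; rewrite eqxx.
case: (g \in perp H) => /=; last by rewrite mulr0 mul0r.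
rewrite /ebasis eq_sym; case: ifP => _; first by rewrite mulr1 mulrC.
by rewrite mulr0 mul0r.
Qed.

Hypothesis horH : forall d : D, ((0, d) : dsum (disc N) D) \in iso_sub H -> d = 0.

(** If (x, d) and (x, e) represent the same class, their difference (0, d - e) lies in H, so d = e:
    the sum has one term. *)
Lemma Phi_coefE F b x d : x \in dual_lattice N ->
  ((disc_coset N x, d) : dsum (disc N) D) \in perp H ->
  coset_perp H ((disc_coset N x, d) : dsum (disc N) D) = b ->
  Phi_coef F b x = F d.
Proof.
move=> xN xdH xdb; rewrite /Phi_coef.
pose g0 : dsum (disc N) D := (disc_coset N x, d).
rewrite -(@fsbig_widen _ _ _ _ [set g0] [set: dsum (disc N) D]) //.
  by rewrite fsbig_set1 /= xN eqxx xdH xdb eqxx.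
move=> [a e] [_ /= ne]; case: ifP => // /and4P[_ /eqP ea gH /eqP gb].
exfalso; apply: ne; rewrite -ea in gH gb *; congr (_, _).
have : g0 - (disc_coset N x, e) \in iso_sub H.
  by apply/(coset_perp_eq xdH gH); rewrite xdb gb.
have -> : g0 - (disc_coset N x, e) = (0, d - e).
  by rewrite /g0 -[LHS]/(_ - _, _ - _) subrr.
by move/horH/eqP; rewrite subr_eq0 => /eqP ->.
Qed.

Lemma Phi_coef0 F b x :
  (forall d, x \in dual_lattice N ->
     ((disc_coset N x, d) : dsum (disc N) D) \in perp H ->
     coset_perp H ((disc_coset N x, d) : dsum (disc N) D) = b -> F d = 0) ->
  Phi_coef F b x = 0.
Proof.
move=> h; rewrite /Phi_coef fsbig1 // => -[a d] _ /=.
by case: ifP => // /and4P[xN /eqP <- xdH /eqP xdb]; exact: h.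
Qed.

End PhiSeries.

Lemma csummable_reindex (R : realType) (T : choiceType) (e : T -> T) (f : T -> R[i]) :
  bijective e -> csummable f -> csummable (f \o e).
Proof.
rewrite -setTT_bijective => be; rewrite /csummable /rsummable /summable.
by rewrite (reindex_esum [set: T] [set: T] e).
Qed.

Lemma theta_termDr (R : realType) (n : nat) (S : quadSpace n) (v : splitting R S)
    tau (zeta : 'rV[R[i]]_n) (nu x : 'rV[rat]_n) :
  theta_term v tau (zeta + toC R nu) x =
  theta_term v tau zeta x * chi R (bil S x nu).
Proof. by rewrite /theta_term /chi -eeD bilDr bil_toC addrA. Qed.

(* The Fourier expansions in zeta of both sides of the transformation law have
   the same coefficients. *)
Lemma Phi_coef_trans (R : realType) (n : nat) (S : quadSpace n) (v : splitting R S)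
    (N : evenLattice S) (D : quadMod) (H : isotropic (dsum (disc N) D))
    (F : upper_half R -> galg R D) (b : perp_quot H) tau (s nu : 'rV[rat]_n) :
  finite_set [set: D] ->
  (forall zeta, Phi v H F tau (elliptic_shift v tau zeta s nu) b =
     ee (- gauss v tau s - bil (gramC R S) (toC R s) zeta) *
       Phi v H F tau zeta b) ->
  forall x, Phi_coef (F tau) b (x - s) * chi R (bil S (x - s) nu) =
            Phi_coef (F tau) b x.
Proof.
move=> finD trans; set A := Phi_coef (F tau) b.
have sA zeta : csummable (fun x => A x * theta_term v tau zeta x).
  exact: csummable_Phi_coef.
pose f zeta x := A x * (theta_term v tau zeta (x + s) * chi R (bil S x nu)).
(* [f] is the shifted series up to a factor independent of x; [g] is [f] reindexed by x - s, so that
   its terms involve the same [theta_term] as the unshifted series. *)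
pose g zeta x := A (x - s) * chi R (bil S (x - s) nu) * theta_term v tau zeta x.
have shiftE zeta x : A x * theta_term v tau (elliptic_shift v tau zeta s nu) x =
    ee (- gauss v tau s - bil (gramC R S) (toC R s) zeta) * f zeta x.
  by rewrite theta_term_shift mulrCA.
have bij : bijective (fun x : 'rV[rat]_n => x - s).
  by exists (fun x => x + s) => x; rewrite ?subrK ?addrK.
have gE zeta : g zeta = f zeta \o (fun x => x - s).
  by apply/funext => x; rewrite /g /f /= subrK mulrAC mulrA.
have sf zeta : csummable (f zeta).
  have := csummableZ (ee (- (- gauss v tau s - bil (gramC R S) (toC R s) zeta)))
    (sA (elliptic_shift v tau zeta s nu)).
  congr csummable; apply/funext => x.
  by rewrite shiftE mulrA [X in X * _]mulrC eeN mul1r.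
have sg zeta : csummable (g zeta).
  by rewrite gE; apply: csummable_reindex.
have csumE zeta : csum [set: 'rV[rat]_n] (g zeta) =
    csum [set: 'rV[rat]_n] (fun x => A x * theta_term v tau zeta x).
  rewrite gE -csum_reindex //.
  apply: (mulfI (ee_neq0 (- gauss v tau s - bil (gramC R S) (toC R s) zeta))).
  apply: etrans (esym (csumZ _ (sf zeta))) _.
  apply: etrans (esym (eq_csum (fun x _ => shiftE zeta x))) _.
  apply: etrans (esym (Phi_series v finD F b tau _)) _.
  by rewrite trans Phi_series.
(* The Gaussian factor is put into the coefficient: then zeta = mu rational multiplies it by a
   character, and as the factor never vanishes it can be cancelled at the end. *)
pose c x := (A (x - s) * chi R (bil S (x - s) nu) - A x) * theta_term v tau 0 x.
have cE mu x : c x * chi R (bil S x mu) =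
    g (toC R mu) x + (-1) * (A x * theta_term v tau (toC R mu) x).
  rewrite /c -mulrA -theta_termDr add0r mulrBl mulN1r; by [].
have sc : csummable c.
  have := csummableD (sg 0) (csummableZ (-1) (sA 0)); congr csummable.
  by apply/funext => x; rewrite /c /g mulrBl mulN1r.
have nc : null_series S c.
  move=> mu; rewrite (eq_csum (fun x _ => cE mu x)).
  rewrite (csumD (sg _) (csummableZ (-1) (sA _))) (csumZ _ (sA _)) csumE.
  by rewrite mulN1r subrr.
move=> x; have /eqP := fourier_unique sc nc x; rewrite /c mulf_eq0 subr_eq0.
by rewrite (negbTE (theta_term_neq0 _ _ _ _)) orbF => /eqP.
Qed.

Lemma coset_perp_sub (E : quadMod) (Y : isotropic E) (x y : E) :
  x \in perp Y -> y \in perp Y -> x - y \in iso_sub Y ->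
  coset_perp Y x = coset_perp Y y.
Proof. by move=> xY yY xyY; apply/(coset_perp_eq xY yY). Qed.

Lemma sub_coset_perp (E : quadMod) (Y : isotropic E) (x y : E) :
  x \in perp Y -> y \in perp Y -> coset_perp Y x = coset_perp Y y ->
  x - y \in iso_sub Y.
Proof. by move=> xY yY xyY; apply/(coset_perp_eq xY yY). Qed.

(** * Comparison of coefficients over L and over Lambda *)

Section Reduction.
Variables (R : realType) (n : nat) (S : quadSpace n) (L M : evenLattice S).
Variables (D : quadMod) (H : isotropic (dsum (disc L) D)).
Hypotheses (horH : horizontal H)
  (LM : forall x, x \in lat L -> x \in lat M)
  (MLd : forall x, x \in lat M -> x \in dual_lattice L)
  (IH : forall a, over_sub M a ->
     exists2 g : dsum (disc L) D, g \in iso_sub H & g.1 = a).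
Local Notation prL x d := ((disc_coset L x, d) : dsum (disc L) D).
Local Notation prM x e := ((disc_coset M x, e) : dsum (disc M) (perp_quot (I_iso M H))).
Local Notation I := (I_iso M H).
Implicit Types (x y : 'rV[rat]_n) (d : D).

Lemma prLB x y d d' : x \in dual_lattice L -> y \in dual_lattice L ->
  prL (x - y) (d - d') = prL x d - prL y d'.
Proof. by move=> xL yL; rewrite -[RHS]/(_ - _, _ - _) /disc_coset coset_perpB. Qed.

Lemma prMB x y d d' : x \in dual_lattice M -> y \in dual_lattice M ->
  d \in perp I -> d' \in perp I ->
  prM (x - y) (coset_perp I (d - d')) =
  prM x (coset_perp I d) - prM y (coset_perp I d').
Proof.
by move=> xM yM dI dI'; rewrite -[RHS]/(_ - _, _ - _) /disc_coset !coset_perpB.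
Qed.

(** The inclusion of Lambda/L in H_L enters here. Together with [I_partner] it gives both directions
    of the correspondence between Lambda and I through H. *)
Lemma over_partner x : x \in lat M ->
  exists2 i, i \in iso_sub I & prL x i \in iso_sub H.
Proof.
move=> xM; have oM : over_sub M (disc_coset L x).
  by exists x => //; split=> //; exact: MLd.
have [[a i] gH /= ax] := IH oM; rewrite ax in gH; exists i => //.
by apply/asboolP; exists (prL x i).
Qed.

Lemma I_partner i : i \in iso_sub I -> exists2 x, x \in lat M & prL x i \in iso_sub H.
Proof.
case/asboolP => -[a i'] [gH [x [xM xL] /= xa] /= ii']; exists x => //.
by rewrite xa -ii'.
Qed.

Lemma dual_sub x : x \in dual_lattice M -> x \in dual_lattice L.
Proof. by move/dual_latticeP => xM; apply/dual_latticeP => y /LM /xM. Qed.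

Lemma perp_partner x d y i : x \in dual_lattice L -> prL x d \in perp H ->
  y \in dual_lattice L -> prL y i \in iso_sub H ->
  toQmodZ (bil S x y) + bform d i = 0.
Proof.
move=> xL /perpP xdH yL yiH.
by have := xdH _ yiH; rewrite dsum_bformE disc_bform.
Qed.

(** By the congruence of [perp_partner], x pairs integrally with y exactly when d is orthogonal to
    the partner of y, and partners exist in both directions. *)
Lemma dual_perp_I x d : x \in dual_lattice L -> prL x d \in perp H ->
  x \in dual_lattice M <-> d \in perp I.
Proof.
move=> xL xdH; split=> [/dual_latticeP xM | /perpP dI].
  apply/perpP => i /I_partner[y yM yiH].
  have := perp_partner xL xdH (MLd yM) yiH.
  by rewrite (toQmodZ_eq0 _).2 ?add0r //; exact: xM.
apply/dual_latticeP => y yM; have [i iI yiH] := over_partner yM.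
apply/toQmodZ_eq0; have := perp_partner xL xdH (MLd yM) yiH.
by rewrite dI // addr0.
Qed.

Lemma perp_Hbar x d : x \in dual_lattice M -> d \in perp I ->
  prL x d \in perp H -> prM x (coset_perp I d) \in perp (Hbar M H).
Proof.
move=> xM dI xdH; apply/perpP => c /asboolP[[a e] geH [y [yL yM /= ya eI ->]]].
rewrite dsum_bformE /= disc_bform // coset_perp_bform //.
by apply: (perp_partner (dual_sub xM) xdH yL); rewrite ya.
Qed.

(** An element (y + L, d) of H whose first component dies in D_Lambda has y in Lambda, so d lies in
    I. This is the half of horizontality that [Phi_coefE] asks for. *)
Lemma horizontal_Hbar (e : perp_quot I) :
  ((0, e) : dsum (disc M) (perp_quot I)) \in iso_sub (Hbar M H) -> e = 0.
Proof.
case/asboolP => -[a d] adH [y [yL yM /= ya dI [y0 ->]]].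
rewrite -(coset_perp0 I).
apply: (@coset_perp_sub _ I) => //; first exact: rpred0.
rewrite subr0.
have yMM : y \in lat M.
  have := (@coset_perp_eq _ (lat_iso M) y 0 yM (rpred0 _)).1.
  by rewrite subr0; apply; rewrite coset_perp0.
by apply/asboolP; exists (a, d); split=> //; exists y.
Qed.

(** The difference of two representatives of b lies in H, and its reduction, the difference of their
    reductions, lies in the reduced subgroup. *)
Lemma p_rel_fun (b : perp_quot H) (a a' : perp_quot (Hbar M H)) :
  p_rel b a -> p_rel b a' -> a = a'.
Proof.
move=> [[g1 d] [c [gH gb [x [xL xM /= xg dI cE]] cH <-]]].
move=> [[g1' d'] [c' [gH' gb' [x' [xL' xM' /= xg' dI' cE']] cH' <-]]].
apply: (@coset_perp_sub _ (Hbar M H)) => //.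
apply/asboolP; exists (prL (x - x') (d - d')).
  rewrite prLB // xg xg'; apply: sub_coset_perp => //.
  by rewrite gb gb'.
exists (x - x'); split; rewrite ?rpredB //=.
by rewrite cE cE' -(prMB xM xM' dI dI').
Qed.

Variable (F : galg R D).
Hypothesis Fsupp : forall d, d \notin perp I -> F d = 0.
Variable G : galg R (perp_quot I).
Hypothesis GF : forall d, d \in perp I -> G (coset_perp I d) = F d.

(** If x occurs over L through d orthogonal to I, the class of d serves over Lambda. If d is not
    orthogonal to I, then F(d) = 0 and x is not in the dual of Lambda, so both sides vanish. If x
    does not occur over L, it does not occur over Lambda either, since an occurrence there lifts. *)
Lemma Phi_coef_reduce (b : perp_quot H) (a : perp_quot (Hbar M H)) x :
  p_rel b a -> Phi_coef F b x = Phi_coef G a x.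
Proof.
move=> [[g1 d0] [c [gH gb [x0 [xL0 xM0 /= xg dI0 cE]] cH ca]]].
rewrite -{}xg in gH gb; rewrite {}cE in cH ca.
case: (pselect (exists d, [/\ x \in dual_lattice L, prL x d \in perp H &
    coset_perp H (prL x d) = b])) => [[d [xL xdH xdb]]|nod].
  rewrite (Phi_coefE horH.2 F xL xdH xdb).
  have [dI|dI] := boolP (d \in perp I).
    have xM := (dual_perp_I xL xdH).2 dI.
    have xdH' := perp_Hbar xM dI xdH.
    rewrite -GF //; apply/esym/Phi_coefE => //; first exact: horizontal_Hbar.
    rewrite -ca; apply: (@coset_perp_sub _ (Hbar M H)) => //; rewrite -prMB //.
    apply/asboolP; exists (prL (x - x0) (d - d0)).
      by rewrite prLB //; apply: sub_coset_perp => //; rewrite xdb gb.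
    by exists (x - x0); split; rewrite ?rpredB.
  rewrite Fsupp // Phi_coef0 // => e xM _ _.
  by move: dI; rewrite ((dual_perp_I xL xdH).1 xM).
rewrite !Phi_coef0 // => [e xM xeH xea|d xL xdH xdb]; last first.
  by case: nod; exists d.
case: nod.
have : prM x e - prM x0 (coset_perp I d0) \in iso_sub (Hbar M H).
  by apply: sub_coset_perp => //; rewrite xea ca.
case/asboolP => -[h1 h2] hH [y [yL yM /= yh hI [xy _]]].
have xL := dual_sub xM.
have lM : x - x0 - y \in lat M.
  have := (@coset_perp_eq _ (lat_iso M) (x - x0) y (rpredB xM xM0) yM).1; apply.
  by rewrite coset_perpB.
have [i iI liH] := over_partner lM.
(* The base point (x0, d0) is moved by the lift (y, h2) in H of the reduced difference; the
   remaining error x - x0 - y lies in Lambda and is matched by its partner i. *)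
exists (d0 + (h2 + i)).
have dH : prL x (d0 + (h2 + i)) - prL x0 d0 \in iso_sub H.
  rewrite -prLB // (addrC d0) addrK.
  have -> : prL (x - x0) (h2 + i) = prL y h2 + prL (x - x0 - y) i.
    rewrite -[RHS]/(_ + _, _ + _) /disc_coset -coset_perpD //; last exact: MLd.
    by rewrite [y + _]addrC subrK.
  by rewrite yh; exact: (@rpredD _ (iso_sub H)).
have dP : prL x (d0 + (h2 + i)) \in perp H.
  by rewrite -(subrK (prL x0 d0) (prL _ _)) rpredD //; exact: iso_sub_perp.
by split=> //; rewrite -gb; apply: (@coset_perp_sub _ H).
Qed.

(** A contributing d orthogonal to I would put b into the domain of p; any other d has F(d) = 0. *)
Lemma Phi_coef_no_p (b : perp_quot H) x :
  (forall a : perp_quot (Hbar M H), ~ p_rel b a) -> Phi_coef F b x = 0.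
Proof.
move=> nop; rewrite Phi_coef0 // => d xL xdH xdb.
have [dI|/Fsupp //] := boolP (d \in perp I).
have xM := (dual_perp_I xL xdH).2 dI.
case: (nop (coset_perp (Hbar M H) (prM x (coset_perp I d)))).
exists (prL x d), (prM x (coset_perp I d)); split=> //; last exact: perp_Hbar.
by exists x.
Qed.

End Reduction.

Theorem theorem5p13 (R : realType) (n : nat) (S : quadSpace n) (bp bm : nat)
    (sgn : has_signature R S bp bm) (L : evenLattice S) (v : splitting R S)
    (D : quadMod) (discD : discriminant_form D)
    (H : isotropic (dsum (disc L) D)) (horH : horizontal H)
    (F : upper_half R -> galg R D) (smoothF : smooth F)
    (Lam : evenLattice S)
    (LsubLam : forall x, x \in lat L -> x \in lat Lam)
    (LamsubLd : forall x, x \in lat Lam -> x \in dual_lattice L)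
    (ILsubHL : forall a, over_sub Lam a ->
       exists2 g : dsum (disc L) D, g \in iso_sub H & g.1 = a)
    (transPhi : forall (beta : perp_quot H) (tau : upper_half R)
         (zeta : 'rV[R[i]]_n) (s nu : 'rV[rat]_n),
       s \in lat Lam -> nu \in lat Lam ->
       Phi v H F tau (elliptic_shift v tau zeta s nu) beta =
       ee (- gauss v tau s - bil (gramC R S) (toC R s) zeta) *
         Phi v H F tau zeta beta) :
  exists G : upper_half R -> galg R (perp_quot (I_iso Lam H)),
    [/\ (forall tau, F tau = up (I_iso Lam H) (G tau)),
        (forall G' : upper_half R -> galg R (perp_quot (I_iso Lam H)),
           (forall tau, F tau = up (I_iso Lam H) (G' tau)) -> G' = G) &
        (forall tau zeta,
           Phi v H F tau zeta = calP Lam H (Phi v (Hbar Lam H) G tau zeta))].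
Proof.
have finD := discD.1.
pose I := I_iso Lam H.
have lift (d : D) : exists2 x, x \in dual_lattice L &
    ((disc_coset L x, d) : dsum (disc L) D) \in perp H.
  have [a aH] := perp_lift R d (disc_discriminant_form L) finD horH.2.
  by have [x xL xa] := disc_coset_surj a; exists x; rewrite ?xa.
have Fsupp tau d : d \notin perp I -> F tau d = 0.
  move=> dI; have [x xL xdH] := lift d.
  have /existsNP[i /not_implyP[iI di]] : ~ (forall i, i \in iso_sub I -> bform d i = 0).
    by move=> h; move/negP: dI; apply; apply/perpP.
  have [y yM yiH] := I_partner iI.
  (* The law with s = 0, nu = y reads F(d) e((x, y)) = F(d). If F(d) were non-zero, (x, y) would be
     integral and hence (d, i) = 0. *)
  have := Phi_coef_trans finD (fun zeta =>
    transPhi (coset_perp H ((disc_coset L x, d) : dsum (disc L) D)) tau zeta 0 y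
      (rpred0 _) yM) x.
  rewrite subr0 (Phi_coefE horH.2 (F tau) xL xdH erefl) => /eqP.
  rewrite -subr_eq0 -{2}[F tau d]mulr1 -mulrBr mulf_eq0 => /orP[/eqP //|].
  rewrite subr_eq0 => /eqP/chi_eq1/toQmodZ_eq0 xy0; case: di.
  by have := perp_partner xL xdH (LamsubLd y yM) yiH; rewrite xy0 add0r.
have Finv tau d i : i \in iso_sub I -> F tau (d - i) = F tau d.
  move=> /I_partner[y yM yiH]; have [x xL xdH] := lift d.
  have yL := LamsubLd y yM.
  (* The law with s = y, nu = 0 equates the coefficients at x - y and x; the former is F(d - i), as
     (x - y, d - i) differs from (x, d) by an element of H. *)
  have := Phi_coef_trans finD (fun zeta =>
    transPhi (coset_perp H ((disc_coset L x, d) : dsum (disc L) D)) tau zeta y 0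
      yM (rpred0 _)) x.
  rewrite bil0r chi0 mulr1 (Phi_coefE horH.2 (F tau) xL xdH erefl) => <-.
  apply/esym/Phi_coefE => //; first exact: horH.2.
  - by rewrite rpredB.
  - by rewrite prLB // rpredB // iso_sub_perp.
  - rewrite prLB //; apply: (@coset_perp_sub _ H) => //.
      by rewrite rpredB // iso_sub_perp.
    by rewrite addrC addKr rpredN.
(* The representative chosen by [repr] is immaterial because F is invariant under I. *)
pose G tau (c : perp_quot I) := F tau (val (repr c : perp_sub I)).
have GF tau d : d \in perp I -> G tau (coset_perp I d) = F tau d.
  move=> dI; rewrite /G; set d' := val _.
  have dI' : d' \in perp I := valP (repr (coset_perp I d) : perp_sub I).
  have dd : d' - d \in iso_sub I.
    by apply: sub_coset_perp => //; rewrite /d' {1}/coset_perp valKd reprK.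
  by rewrite -(Finv tau d' _ dd) subKr.
exists G; split.
- move=> tau; apply/funext => d; rewrite upE; case: ifPn => dI; first by rewrite GF.
  exact: Fsupp.
- move=> G' FG'; apply/funext => tau; apply/funext => c.
  have [d dI <-] := coset_perp_surj c; rewrite GF // FG' upE.
  by rewrite ifT.
- move=> tau zeta; apply/funext => b; rewrite Phi_series //.
  (* For b outside the domain of p the right side is 0 by definition of [calP], and the coefficients
     on the left vanish one by one. *)
  have [[a ba]|/forallNP nob] := pselect (exists a : perp_quot (Hbar Lam H), p_rel b a).
    rewrite (calPE _ _ ba); last by move=> a' ba'; exact: p_rel_fun ba' ba.
    rewrite Phi_series; last exact: perp_quot_finite.
    apply: eq_csum => x _; congr (_ * _).
    exact: (Phi_coef_reduce horH LsubLam LamsubLd ILsubHL (Fsupp tau) (GF tau)).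
  rewrite calP0 // -[RHS](csum0 R 'rV[rat]_n); apply: eq_csum => x _.
  by rewrite (Phi_coef_no_p LsubLam LamsubLd ILsubHL (Fsupp tau) _ nob) mul0r.
Qed.
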